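(* Let $(R,\mathfrak m,\kappa)$ be an $F$-finite, $F$-pure Noetherian local ring of prime characteristic $p>0$ with perfect residue field $\kappa$. Then there exists a prime ideal $\mathcal P=\mathcal P(R)$ of $R$ (the splitting prime defined in the context) such that $R/\mathcal P$ is strongly $F$-regular and $\operatorname{sdim}(R)\le \dim(R/\mathcal P)$. The prime $\mathcal P$ is $0$ if and only if $R$ is strongly $F$-regular.
   Context: All rings are commutative and Noetherian; $q=p^e$ denotes a power of the characteristic $p$. For a ring $R$ of characteristic $p$, $F^e:R\to R$, $r\mapsto r^{p^e}$, is the $e$-th iterate of the Frobenius map $F$, and $R^{(e)}$ is $R$ viewed as an $R$-algebra via $F^e$. $R$ is $F$-finite if $R^{(1)}$ is a finite $R$-module. $R$ is $F$-pure if $F\otimes_R M$ is injective for every $R$-module $M$ (such $R$ is reduced). For reduced $R$, $R^{1/q}$ is the ring of $q$-th roots of elements of $R$; $R^{1/q}\cong R^{(e)}$ as $R$-algebras. A reduced $F$-finite ring $R$ is strongly $F$-regular if for every $c\in R$ lying in no minimal prime of $R$ there is $q$ such that the $R$-linear map $R\to R^{1/q}$, $1\mapsto c^{1/q}$, splits over $R$. For $R$ reduced, local and $F$-finite, write $R^{1/q}\cong R^{a_q}\oplus M_q$ as $R$-modules, where $M_q$ has no nonzero free direct summand; $a_q$ does not depend on the decomposition. When $R$ is $F$-pure with perfect residue field, the $s$-dimension $\operatorname{sdim}(R)$ is the largest integer $j$ such that $\liminf_{q\to\infty} a_q/q^{j}>0$. Let $E=E_R(\kappa)$ be the injective hull of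 the residue field and $u$ a generator of the socle of $E$. Set $A_e(R)=\{r\in R: r\otimes u=0 \text{ in } R^{(e)}\otimes_R E\}$. The splitting prime is $\mathcal P(R)=\{r\in R: r\otimes u=0\text{ in }R^{(e)}\otimes_R E\text{ for all }e\gg0\}=\bigcap_{e\ge1}A_e(R)$. *)

(* Defs.v *)
From HB Require Import structures.
From mathcomp Require Import all_boot all_order all_algebra.
From mathcomp Require Import generic_quotient ring_quotient finmap.
From mathcomp Require Import boolp classical_sets reals constructive_ereal.
From mathcomp Require Import ereal topology sequences.
From mathcomp Require Import -(notations) monalg.

Set Implicit Arguments.
Unset Strict Implicit.
Unset Printing Implicit Defensive.

Import GRing.Theory.

Local Open Scope ring_scope.
Local Open Scope quotient_scope.

(* The notations of [monalg] clash with those of [topology]. *)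
Local Notation "<< k >>" := (mkmalgU k 1) : ring_scope.

Section Span.
Variables (R : nzRingType) (V : lmodType R).

Definition module_span (G : V -> Prop) (v : V) : Prop :=
  exists s : seq (R * V),
    (forall c, c \in s -> G c.2) /\ v = \sum_(c <- s) c.1 *: c.2.

Definition spanp (G : V -> Prop) : V -> bool := fun v => `[< module_span G v >].

Lemma spanp_submod_closed G : submod_closed (spanp G).
Proof.
split=> [|a u v /asboolP[s [sG ->]] /asboolP[t [tG ->]]]; apply/asboolP.
  by exists [::]; split=> //; rewrite big_nil.
exists ([seq (a * c.1, c.2) | c <- s] ++ t); split=> [c|].
  by rewrite mem_cat => /orP[/mapP[d ds ->]|/tG//]; exact: sG ds.
rewrite big_cat big_map scaler_sumr; congr (_ + _).
by apply: eq_bigr => c _; rewrite scalerA.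
Qed.

HB.instance Definition _ G :=
  GRing.isSubmodClosed.Build R V (spanp G) (spanp_submod_closed G).

Definition span_submod (G : V -> Prop) : submodClosed V :=
  GRing.SubmodClosed.clone R V (spanp G) _.

Lemma mem_span (G : V -> Prop) v : G v -> v \in span_submod G.
Proof.
move=> Gv; apply/asboolP; exists [:: (1, v)]; split=> [c|].
  by rewrite inE => /eqP->.
by rewrite big_seq1 scale1r.
Qed.

Definition finite_module : Prop :=
  exists s : seq V, forall v, module_span (fun w => w \in s) v.

End Span.
Arguments finite_module {R} V.

Section ModuleQuotient.
Variables (R : nzRingType) (V : lmodType R) (S : submodClosed V).

(* [submodClosed] does not inherit from [zmodClosed]. *)
Definition submod_pred : V -> bool := fun v => v \in S.
HB.instance Definition _ := GRing.isZmodClosed.Build V submod_pred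
  (GRing.submod_closedB (submodClosedP S)).

Local Notation quotS := (Quotient.quot (GRing.ZmodClosed.clone V submod_pred _)).

Definition modquot : Type := quotS.
HB.instance Definition _ := GRing.Zmodule.on modquot.

Definition mod_pi (v : V) : modquot := \pi_(quotS) v.
Definition mod_repr (x : modquot) : V := repr (x : quotS).

Lemma mod_reprK : cancel mod_repr mod_pi.
Proof. by move=> x; exact: (@reprK V quotS). Qed.

Lemma mod_piP u v : mod_pi u = mod_pi v <-> u - v \in S.
Proof. by split=> [/eqP|H]; [|apply/eqP]; rewrite -[_ == _]Quotient.idealrBE. Qed.

Lemma mod_piD : {morph mod_pi : u v / u + v}.
Proof. by move=> u v; exact: (raddfD (\pi_(quotS))). Qed.

Definition mod_scale (a : R) (x : modquot) := mod_pi (a *: mod_repr x).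

Lemma mod_scaleE a v : mod_scale a (mod_pi v) = mod_pi (a *: v).
Proof.
apply/mod_piP; rewrite -scalerBr rpredZ //; apply/mod_piP.
exact: mod_reprK.
Qed.

Lemma mod_scaleA a b x : mod_scale a (mod_scale b x) = mod_scale (a * b) x.
Proof. by rewrite -(mod_reprK x) !mod_scaleE scalerA. Qed.

Lemma mod_scale1 : left_id 1 mod_scale.
Proof. by move=> x; rewrite -(mod_reprK x) mod_scaleE scale1r. Qed.

Lemma mod_scaleDr : right_distributive mod_scale +%R.
Proof.
move=> a x y; rewrite -(mod_reprK x) -(mod_reprK y).
by rewrite -mod_piD !mod_scaleE scalerDr mod_piD.
Qed.

Lemma mod_scaleDl x : {morph mod_scale^~ x : a b / a + b}.
Proof.
by move=> a b; rewrite -(mod_reprK x) /= !mod_scaleE scalerDl mod_piD.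
Qed.

HB.instance Definition _ := GRing.Zmodule_isLmodule.Build R modquot
  mod_scaleA mod_scale1 mod_scaleDr mod_scaleDl.

Lemma mod_pi_linear : linear mod_pi.
Proof. by move=> a u v; rewrite mod_piD -mod_scaleE. Qed.

HB.instance Definition _ := GRing.isLinear.Build R V modquot *:%R mod_pi
  mod_pi_linear.

End ModuleQuotient.

Section Tensor.
Variables (R : comNzRingType) (N M : lmodType R).

Variant tensor_relator : malg (N * M)%type R -> Prop :=
| TensorDl (n n' : N) (m : M) :
    tensor_relator (<< (n + n', m) >> - << (n, m) >> - << (n', m) >>)
| TensorDr (n : N) (m m' : M) :
    tensor_relator (<< (n, m + m') >> - << (n, m) >> - << (n, m') >>)
| TensorZl (a : R) (n : N) (m : M) :
    tensor_relator (<< (a *: n, m) >> - a *: << (n, m) >>)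
| TensorZr (a : R) (n : N) (m : M) :
    tensor_relator (<< (n, a *: m) >> - a *: << (n, m) >>).

Definition tensor : Type := modquot (span_submod tensor_relator).
HB.instance Definition _ := GRing.Lmodule.on tensor.

Definition tens (n : N) (m : M) : tensor :=
  mod_pi (span_submod tensor_relator) << (n, m) >>.

Lemma tensDl n n' m : tens (n + n') m = tens n m + tens n' m.
Proof.
rewrite /tens -mod_piD; apply/mod_piP/mem_span.
by rewrite opprD addrA; apply: TensorDl.
Qed.

Lemma tensDr n m m' : tens n (m + m') = tens n m + tens n m'.
Proof.
rewrite /tens -mod_piD; apply/mod_piP/mem_span.
by rewrite opprD addrA; apply: TensorDr.
Qed.

Lemma tensZl a n m : tens (a *: n) m = a *: tens n m.
Proof. by rewrite /tens -linearZ; apply/mod_piP/mem_span; apply: TensorZl. Qed.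

Lemma tensZr a n m : tens n (a *: m) = a *: tens n m.
Proof. by rewrite /tens -linearZ; apply/mod_piP/mem_span; apply: TensorZr. Qed.

Variable T : lmodType R.

Definition bilinear_map (phi : N -> M -> T) : Prop :=
  (forall m, linear (phi^~ m)) /\ (forall n, linear (phi n)).

Definition free_lift (phi : N -> M -> T) (g : malg (N * M)%type R) : T :=
  \sum_(k <- msupp g) mcoeff k g *: phi k.1 k.2.

(* Meaningful for bilinear [phi] only: see [tensor_lift_tens]. *)
Definition tensor_lift (phi : N -> M -> T) (x : tensor) : T :=
  free_lift phi (mod_repr x).

Lemma free_liftEw phi g (d : {fset N * M}) : (msupp g `<=` d)%fset ->
  free_lift phi g = \sum_(k <- d) mcoeff k g *: phi k.1 k.2.
Proof.
move=> gd; rewrite /free_lift; apply: big_fset_incl => // k _ kg.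
by rewrite mcoeff_outdom ?scale0r.
Qed.

Lemma free_lift_linear phi : linear (free_lift phi).
Proof.
move=> a u v; pose d := (msupp u `|` msupp v `|` msupp (a *: u + v))%fset.
have du : (msupp u `<=` d)%fset by rewrite /d -fsetUA fsubsetUl.
have dv : (msupp v `<=` d)%fset by rewrite /d fsetUAC fsubsetUr.
have duv : (msupp (a *: u + v) `<=` d)%fset by rewrite /d fsubsetUr.
rewrite (free_liftEw _ du) (free_liftEw _ dv) (free_liftEw _ duv).
rewrite scaler_sumr -big_split; apply: eq_bigr => k _ /=.
by rewrite mcoeffD mcoeffZ scalerDl scalerA.
Qed.

HB.instance Definition _ phi :=
  GRing.isLinear.Build R (malg (N * M)%type R) T *:%R (free_lift phi)
    (free_lift_linear phi).

Lemma free_liftU phi n m : free_lift phi << (n, m) >> = phi n m.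
Proof.
by rewrite (free_liftEw _ msuppU_le) big_seq_fset1 mcoeffUU scale1r.
Qed.

Lemma free_lift_relator phi g : bilinear_map phi ->
  g \in span_submod tensor_relator -> free_lift phi g = 0.
Proof.
move=> [phil phir] /asboolP[s [sG ->]]; rewrite linear_sum big_seq big1 // => c.
move=> /sG c_rel; rewrite linearZ /=.
suff -> : free_lift phi c.2 = 0 by rewrite scaler0.
case: c_rel => [n n' m|n m m'|a n m|a n m].
- rewrite !linearB /= !free_liftU.
  by have /= := phil m 1 n n'; rewrite !scale1r => ->; rewrite -addrA -opprD subrr.
- rewrite !linearB /= !free_liftU.
  by have /= := phir n 1 m m'; rewrite !scale1r => ->; rewrite -addrA -opprD subrr.
- have phi0 : phi 0 m = 0.
    by have /= := phil m (-1) 0 0; rewrite scaler0 addr0 scaleN1r addNr.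
  rewrite linearB linearZ /= !free_liftU.
  by have /= := phil m a n 0; rewrite addr0 phi0 addr0 => ->; rewrite subrr.
- have phi0 : phi n 0 = 0.
    by have /= := phir n (-1) 0 0; rewrite scaler0 addr0 scaleN1r addNr.
  rewrite linearB linearZ /= !free_liftU.
  by have /= := phir n a m 0; rewrite addr0 phi0 addr0 => ->; rewrite subrr.
Qed.

Lemma tensor_lift_pi phi g : bilinear_map phi ->
  tensor_lift phi (mod_pi (span_submod tensor_relator) g) = free_lift phi g.
Proof.
move=> phiP; apply/eqP; rewrite -subr_eq0 -linearB; apply/eqP.
by apply: free_lift_relator => //; apply/mod_piP; rewrite mod_reprK.
Qed.

Lemma tensor_lift_tens phi n m : bilinear_map phi ->
  tensor_lift phi (tens n m) = phi n m.
Proof. by move=> phiP; rewrite tensor_lift_pi// free_liftU. Qed.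

Lemma tensor_lift_linear phi : bilinear_map phi -> linear (tensor_lift phi).
Proof.
move=> phiP a x y; rewrite -(mod_reprK x) -(mod_reprK y) -linearP.
by rewrite !tensor_lift_pi// linearP.
Qed.

End Tensor.

Section TensorMap.
Variables (R : comNzRingType) (N N' : lmodType R) (f : {linear N -> N'}).
Variable M : lmodType R.

Definition tensor_map : tensor N M -> tensor N' M :=
  tensor_lift (fun n m => tens (f n) m).

Lemma tensor_map_bilinear : bilinear_map (fun n (m : M) => tens (f n) m).
Proof.
split=> [m|n] a u v; first by rewrite linearP tensDl tensZl.
by rewrite tensDr tensZr.
Qed.

Lemma tensor_mapE n m : tensor_map (tens n m) = tens (f n) m.
Proof. exact: tensor_lift_tens tensor_map_bilinear. Qed.

HB.instance Definition _ :=
  GRing.isLinear.Build R (tensor N M) (tensor N' M) *:%R tensor_map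
    (tensor_lift_linear tensor_map_bilinear).

End TensorMap.
Arguments tensor_map {R N N'} f M.

Section InjectiveHull.
Variable R : nzRingType.

Definition injective_module (E : lmodType R) : Prop :=
  forall (M N : lmodType R) (f : {linear M -> N}) (g : {linear M -> E}),
    injective f -> exists h : {linear N -> E}, forall x, h (f x) = g x.

Definition essential (M E : lmodType R) (iota : {linear M -> E}) : Prop :=
  forall S : submodClosed E, (exists2 x, x \in S & x != 0) ->
    exists2 y, iota y \in S & iota y != 0.

Definition injective_hull (M E : lmodType R) (iota : {linear M -> E}) : Prop :=
  [/\ injective_module E, injective iota & essential iota].

Definition isomorphic (M N : lmodType R) : Prop :=
  exists f : {linear M -> N}, bijective f.

Definition free_rank (M : lmodType R) (a : nat) : Prop :=
  exists N : lmodType R, isomorphic M ('rV[R]_a * N)%type /\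
    forall (n : nat) (N' : lmodType R),
      isomorphic N ('rV[R]_n * N')%type -> n = 0%N.

End InjectiveHull.

(* Classically every ideal or submodule is a boolean predicate, so [idealr],
   [prime_idealr] and [submodClosed] lose no generality. *)
Section Rings.
Variable R : comNzRingType.

Definition noetherian : Prop :=
  forall I : idealr R, exists s : seq R,
    forall x, x \in I <-> module_span (fun y : R^o => y \in s) x.

Definition reduced : Prop := forall (x : R) (n : nat), x ^+ n = 0 -> x = 0.

Definition maximal_ideal (I : idealr R) : Prop :=
  forall J : idealr R, {subset I <= J} -> J =i I.

Definition local_ring (m : idealr R) : Prop :=
  maximal_ideal m /\ forall J : idealr R, maximal_ideal J -> J =i m.

Definition minimal_prime (Q : prime_idealr R) : Prop :=
  forall Q' : prime_idealr R, {subset Q' <= Q} -> Q' =i Q.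

Definition prime_chain (n : nat) : Prop :=
  exists Q : 'I_n.+1 -> prime_idealr R, forall i j : 'I_n.+1, (i < j)%N ->
    {subset Q i <= Q j} /\ ~ {subset Q j <= Q i}.

Definition krull_dim (K : realType) : \bar K :=
  ereal_sup [set (n%:R)%:E | n in [set n | prime_chain n]]%classic.

(* For R local, the sum of the simple submodules is the annihilator of m. *)
Definition socle (m : idealr R) (E : lmodType R) (x : E) : Prop :=
  forall r, r \in m -> r *: x = 0.

Definition socle_generator (m : idealr R) (E : lmodType R) (u : E) : Prop :=
  forall x, socle m x <-> exists r : R, x = r *: u.

End Rings.

Section QuotientRingModule.
Variables (R : comNzRingType) (I : idealr R).

Definition quot_scale (a : R) (x : {ideal_quot I}) : {ideal_quot I} :=
  \pi_{ideal_quot I} a * x.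

Lemma quot_scaleA a b x : quot_scale a (quot_scale b x) = quot_scale (a * b) x.
Proof. by rewrite /quot_scale rmorphM mulrA. Qed.

Lemma quot_scale1 : left_id 1 quot_scale.
Proof. by move=> x; rewrite /quot_scale rmorph1 mul1r. Qed.

Lemma quot_scaleDr : right_distributive quot_scale +%R.
Proof. by move=> a x y; rewrite /quot_scale mulrDr. Qed.

Lemma quot_scaleDl x : {morph quot_scale^~ x : a b / a + b}.
Proof. by move=> a b; rewrite /quot_scale raddfD mulrDl. Qed.

HB.instance Definition _ := GRing.Zmodule_isLmodule.Build R {ideal_quot I}
  quot_scaleA quot_scale1 quot_scaleDr quot_scaleDl.

Lemma quot_pchar p : p \in [pchar R] -> p \in [pchar {ideal_quot I}].
Proof. exact: (rmorph_pchar (\pi_{ideal_quot I})). Qed.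

End QuotientRingModule.

Section Frobenius.
Variables (R : comNzRingType) (p : nat) (chRp : p \in [pchar R]).

(* R^(e): the ring R, with a *: x = a ^ (p ^ e) * x.  When R is reduced,
   x |-> x ^ (p ^ e) is an isomorphism of R-algebras from R^(1/q) to R^(e),
   which maps c^(1/q) to c; R^(e) stands for R^(1/q) throughout. *)
Definition frob_alg (ch : p \in [pchar R]) (e : nat) : Type := R.

Local Notation "R^( e )" := (frob_alg chRp e) (at level 0, format "R^( e )").

HB.instance Definition _ e := GRing.ComNzRing.copy R^(e) R.

Definition frob_scale e (a : R) (x : R^(e)) : R^(e) := (a ^+ (p ^ e) : R) * x.

Lemma frob_scaleA e a b x :
  @frob_scale e a (frob_scale b x) = frob_scale (a * b) x.
Proof. by rewrite /frob_scale exprMn mulrA. Qed.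

Lemma frob_scale1 e : left_id 1 (@frob_scale e).
Proof. by move=> x; rewrite /frob_scale expr1n mul1r. Qed.

Lemma frob_scaleDr e : right_distributive (@frob_scale e) +%R.
Proof. by move=> a x y; rewrite /frob_scale mulrDr. Qed.

Lemma frobD e : {morph (fun a : R => a ^+ (p ^ e)) : a b / a + b}.
Proof.
move=> a b; apply: exprDn_pchar; apply/pnatP.
  by rewrite expn_gt0 prime_gt0 ?(pcharf_prime chRp).
move=> q q_prime; case: e => [|e].
  by rewrite dvdn1 => /eqP q1; rewrite q1 in q_prime.
rewrite Euclid_dvdX // => /andP[+ _].
by rewrite dvdn_prime2 ?(pcharf_prime chRp)// => /eqP->.
Qed.

Lemma frob_scaleDl e x : {morph (@frob_scale e)^~ x : a b / a + b}.
Proof. by move=> a b; rewrite /frob_scale frobD mulrDl. Qed.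

HB.instance Definition _ e := GRing.Zmodule_isLmodule.Build R R^(e)
  (@frob_scaleA e) (@frob_scale1 e) (@frob_scaleDr e) (@frob_scaleDl e).

Lemma frob_scaleAl e (a : R) (x y : R^(e)) : a *: (x * y) = a *: x * y.
Proof. by rewrite /GRing.scale /= /frob_scale mulrA. Qed.

HB.instance Definition _ e := GRing.Lmodule_isLalgebra.Build R R^(e)
  (@frob_scaleAl e).

Definition frob e (r : R^o) : R^(e) := (r : R) ^+ (p ^ e).

Lemma frob_linear e : linear (@frob e).
Proof. by move=> a x y; rewrite /frob frobD exprMn. Qed.

HB.instance Definition _ e :=
  GRing.isLinear.Build R R^o R^(e) *:%R (@frob e) (@frob_linear e).

Definition F_finite : Prop := finite_module R^(1).

Definition F_pure : Prop :=
  forall M : lmodType R, injective (tensor_map (@frob 1) M).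

Definition strongly_F_regular : Prop :=
  [/\ reduced R, F_finite &
    forall c : R,
      (forall Q : prime_idealr R, minimal_prime Q -> c \notin Q) ->
      exists (e : nat) (g : {linear R^(e) -> R^o}),
        cancel (fun r : R^o => (r : R) *: (c : R^(e))) g].

Definition is_sdim (K : realType) (s : int) : Prop :=
  exists a : nat -> nat, (forall e, free_rank R^(e) (a e)) /\
    let liminf_pos (j : int) :=
      (0 < limn_einf (fun e => ((a e)%:R / (p ^ e)%:R ^ j : K)%:E))%E in
    liminf_pos s /\ forall j, liminf_pos j -> (j <= s)%R.

(* A_e(R) *)
Definition frob_tensor_kernel (E : lmodType R) (u : E) (e : nat) (r : R) : Prop :=
  tens (r : R^(e)) u = 0.

Definition splitting_prime (E : lmodType R) (u : E) (r : R) : Prop :=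
  exists e0 : nat, forall e, (e0 <= e)%N -> frob_tensor_kernel u e r.

End Frobenius.

Definition perfect (p : nat) (A : comNzRingType) : Prop :=
  forall x : A, exists y : A, y ^+ p = x.

(* Main.v *)
Require Import Defs.
From HB Require Import structures.
From mathcomp Require Import all_boot all_order all_algebra.
From mathcomp Require Import generic_quotient ring_quotient ring.
From mathcomp Require Import boolp classical_sets reals constructive_ereal.
From mathcomp Require Import ereal topology normedtype sequences.

(* A Cartier map of level [e] is an additive [phi : R -> R] with
   [phi (a^q x) = a phi x], that is an [R]-linear map [R^(e) -> R].  As [E] is
   the injective hull of the residue field, [r (x) u] is nonzero in
   [R^(e) (x) E] if and only if some Cartier map of level [e] sends [r] to [1].
   The splitting prime [P] is thus the set of the elements that no Cartier map
   of any level sends out of [m].  Cartier maps compose, so they preserve [P]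
   and induce Cartier maps of [R/P], which makes [R/P] strongly F-regular; and
   [P] is prime because [phi r = psi s = 1] imply [psi (phi (r s^q)) = 1].

   If [R] is strongly F-regular and [r] lies in [P], choose [s] with [r s = 0]
   and [r + s] a nonzerodivisor, and [phi] with [phi (r + s) = 1].  Then
   [phi s] is a unit, and [r (phi s) = phi (r^q s) = 0], so that [r = 0].

   A free direct summand of rank [a] of [R^(e)] gives [a] Cartier maps whose
   residues modulo [m] kill [P] and [x^q R] for every [x] in [m].  If [P] and
   [x_1, ..., x_d] generate an m-primary ideal, the perfectness of the residue
   field yields a bound [a <= C q^d] with [C] independent of [e].  Finally, for
   every [n], either [R/P] has a chain of [n + 1] primes, or there are such
   [x_1, ..., x_d] with [d < n]. *)

Set Implicit Arguments.
Unset Strict Implicit.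
Unset Printing Implicit Defensive.

Import Order.TTheory GRing.Theory Num.Theory.
Local Open Scope ring_scope.
Local Open Scope quotient_scope.

(** * Noetherian modules *)

Section Submodules.
Variables (R : nzRingType) (V : lmodType R).
Implicit Types (S T : V -> Prop) (s : seq V).

Definition submodule S : Prop :=
  S 0 /\ forall a u v, S u -> S v -> S (a *: u + v).

Lemma submoduleD S u v : submodule S -> S u -> S v -> S (u + v).
Proof. by move=> [_ SP] Su Sv; rewrite -[u]scale1r; apply: SP. Qed.

Lemma submoduleZ S a u : submodule S -> S u -> S (a *: u).
Proof. by move=> [S0 SP] Su; rewrite -[_ *: _]addr0; apply: SP. Qed.

Lemma submoduleB S u v : submodule S -> S u -> S v -> S (u - v).
Proof. by move=> [_ SP] Su Sv; rewrite -scaleN1r addrC; apply: SP. Qed.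

Lemma submodule_sum S I (r : seq I) (Q : pred I) (F : I -> V) :
  submodule S -> (forall i, Q i -> S (F i)) -> S (\sum_(i <- r | Q i) F i).
Proof.
move=> SS SF; elim/big_ind: _ => //; first by case: SS.
by move=> x y; apply: submoduleD.
Qed.

Lemma module_span_submodule (G : V -> Prop) : submodule (module_span G).
Proof.
split=> [|a u v /asboolP Gu /asboolP Gv]; apply/asboolP.
  exact: (rpred0 (span_submod G)).
by apply: (rpredD (S := span_submod G)); first apply: rpredZ.
Qed.

Lemma sub_module_span (G : V -> Prop) v : G v -> module_span G v.
Proof. by move=> /mem_span/asboolP. Qed.

Lemma module_span_min (G : V -> Prop) S : submodule S ->
  (forall v, G v -> S v) -> forall v, module_span G v -> S v.
Proof.
move=> SS GS v [s [sG ->]]; rewrite big_seq; apply: submodule_sum => // c /sG.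
by move=> /GS; apply: submoduleZ.
Qed.

Lemma module_spanS (G H : V -> Prop) : (forall v, G v -> H v) ->
  forall v, module_span G v -> module_span H v.
Proof.
move=> GH; apply: module_span_min; first exact: module_span_submodule.
by move=> v /GH; apply: sub_module_span.
Qed.

Lemma mem_span_submodule S v : submodule S -> (v \in span_submod S) <-> S v.
Proof.
move=> SS; split=> [/asboolP|]; last exact: mem_span.
exact: module_span_min.
Qed.

Lemma module_span_nth s v : module_span (fun w => w \in s) v ->
  exists c : 'rV[R]_(size s), v = \sum_i c 0 i *: s`_i.
Proof.
move: v; apply: module_span_min => [|v].
  split=> [|a _ _ [c ->] [d ->]].
    by exists 0; rewrite big1 // => i _; rewrite mxE scale0r.
  exists (a *: c + d); rewrite scaler_sumr -big_split; apply: eq_bigr => i _ /=.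
  by rewrite !mxE scalerDl scalerA.
move=> /(nthP 0)[i lti <-]; exists (delta_mx 0 (Ordinal lti)).
rewrite (bigD1 (Ordinal lti)) //= big1 ?addr0 => [|j /negPf jN].
  by rewrite mxE !eqxx scale1r.
by rewrite mxE jN andbF scale0r.
Qed.

Definition fin_gen S : Prop := exists s,
  (forall v, v \in s -> S v) /\ forall v, S v -> module_span (fun w => w \in s) v.

Definition noetherian_module : Prop := forall S, submodule S -> fin_gen S.

(** Otherwise dependent choice gives a strictly increasing sequence of submodules satisfying [Phi].
    Its union is finitely generated and the generators already lie in one term, so that the sequence
    stops there. *)
Lemma noetherian_max (Phi : (V -> Prop) -> Prop) S0 :
    noetherian_module -> submodule S0 -> Phi S0 ->
  exists S, [/\ submodule S, Phi S & forall T, submodule T -> Phi T ->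
    (forall v, S v -> T v) -> forall v, T v -> S v].
Proof.
move=> noethV SS0 PhiS0; apply: contrapT => no_max.
pose X := {S : V -> Prop | submodule S /\ Phi S}.
have next (A : X) : exists B : X,
    (forall v, sval A v -> sval B v) /\ exists2 v, sval B v & ~ sval A v.
  case: A => S [SS PhiS] /=; apply: contrapT => noB; apply: no_max.
  exists S; split=> // T ST PhiT leST v Tv; apply: contrapT => nSv; apply: noB.
  by exists (exist _ T (conj ST PhiT)); split=> //; exists v.
have [f fP] := choice next.
pose A n := iter n f (exist _ S0 (conj SS0 PhiS0)).
have AS n : submodule (sval (A n)) by case: (A n) => S [].
have leA i j : (i <= j)%N -> forall v, sval (A i) v -> sval (A j) v.
  move=> /subnKC <-; elim: (j - i)%N => [|k IH] v; first by rewrite addn0.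
  by move=> /IH; rewrite addnS /A iterS; apply: (fP _).1.
have [|s [sU Us]] := noethV (fun v => exists n, sval (A n) v).
  split=> [|a u v [i Ai] [j Aj]]; first by exists 0%N; exact: SS0.1.
  exists (maxn i j); apply: (AS _).2; [apply: leA Ai|apply: leA Aj].
    exact: leq_maxl.
  exact: leq_maxr.
have [n sn] : exists n, forall v, v \in s -> sval (A n) v.
  elim: s sU {Us} => [|x s IH] sU; first by exists 0%N.
  have [n An] := IH (fun v vs => sU v (mem_behead (s := x :: s) vs)).
  have [k Ak] := sU x (mem_head _ _).
  exists (maxn n k) => v; rewrite inE => /predU1P[->|/An].
    exact: leA (leq_maxr _ _) _ Ak.
  exact: leA (leq_maxl _ _) _.
have [_ [v Av]] := fP (A n); apply.
apply: (module_span_min (AS n) sn); apply: Us; exists n.+1; exact: Av.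
Qed.

End Submodules.

Section Ideals.
Variable R : comNzRingType.
Implicit Types (I J : R^o -> Prop) (x y : R).

Notation ideal := (@submodule R R^o).

Lemma ideal_mull I x y : ideal I -> I y -> I (x * y).
Proof. exact: submoduleZ. Qed.

Lemma ideal_mulr I x y : ideal I -> I x -> I (x * y).
Proof. by rewrite mulrC; apply: ideal_mull. Qed.

Lemma idealr_ideal (I : idealr R) : ideal (fun x => x \in I).
Proof.
by split=> [|a u v Iu Iv]; [exact: rpred0|rewrite rpredD //; exact: idealMr].
Qed.

(** An [idealr] is proper by definition. Ideals are therefore handled as submodules of [R^o], among
    which the unit ideal is allowed, and are converted only when needed. *)
Lemma ideal_idealr I : ideal I -> ~ I 1 -> {J : idealr R | forall x, x \in J <-> I x}.
Proof.
move=> II I1; pose S : R -> bool := fun x => `[< I x >].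
have SP : idealr_closed S.
  split=> [||a u v /asboolP Iu /asboolP Iv]; apply/asboolP => //.
    by case: II.
  exact: II.2.
pose J : idealr R := HB.pack S (isIdealr.Build R S SP).
by exists J => x; split=> [/asboolP|Ix]; last apply/asboolP.
Qed.

Definition prime_ideal I : Prop :=
  [/\ ideal I, ~ I 1 & forall x y, I (x * y) -> I x \/ I y].

Lemma prime_idealrP (Q : prime_idealr R) : prime_ideal (fun x => x \in Q).
Proof.
split; first exact: idealr_ideal.
  by rewrite idealr1.
by move=> x y; rewrite prime_idealrM => /orP.
Qed.

Lemma ideal_prime_idealr I : prime_ideal I ->
  {J : prime_idealr R | forall x, x \in J <-> I x}.
Proof.
move=> [II I1 IP]; pose S : R -> bool := fun x => `[< I x >].
have SP : idealr_closed S.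
  split=> [||a u v /asboolP Iu /asboolP Iv]; apply/asboolP => //.
    by case: II.
  exact: II.2.
have SP' : prime_idealr_closed S.
  by move=> u v /asboolP/IP[]/asboolP uv; apply/orP; [left|right].
pose J : prime_idealr R := HB.pack S (isIdealr.Build R S SP)
  (isPrimeIdealrClosed.Build R S SP').
by exists J => x; split=> [/asboolP|Ix]; last apply/asboolP.
Qed.

Hypothesis noethR : noetherian R.

Lemma noetherian_regular : noetherian_module R^o.
Proof.
move=> I II; have [I1|I1] := pselect (I 1).
  exists [:: 1 : R^o]; split=> [x|x _]; first by rewrite inE => /eqP->.
  rewrite -[x]mulr1; apply: submoduleZ (module_span_submodule _) _.
  by apply: sub_module_span; rewrite mem_head.
have [J JP] := ideal_idealr II I1; have [s sP] := noethR J.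
exists s; split=> [x xs|x /JP/sP//]; apply/JP/sP.
exact: (sub_module_span (V := R^o)).
Qed.

(** Induction on the number [k] of coordinates that may be nonzero. The values of the last of them
    form an ideal; lifts of its generators, together with generators of the submodule where this
    coordinate vanishes, generate [S]. *)
Lemma noetherian_rV n : noetherian_module 'rV[R]_n.
Proof.
move=> S SS; suff H k : forall S : 'rV[R]_n -> Prop, submodule S ->
    (forall v, S v -> forall i : 'I_n, (k <= i)%N -> v 0 i = 0) -> fin_gen S.
  by apply: (H n _ SS) => v _ i; rewrite leqNgt ltn_ord.
elim: k => [|k IH] {SS}S SS S0.
  exists [::]; split=> // v Sv; suff -> : v = 0.
    by case: (module_span_submodule (fun w : 'rV[R]_n => w \in [::])).
  by apply/rowP => i; rewrite mxE (S0 _ Sv).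
have [ltkn|lenk] := ltnP k n; last first.
  by apply: IH => // v Sv i ki; case: (leqP n i) (ltn_ord i) (leq_trans lenk ki).
pose k' := Ordinal ltkn.
have [|l [lS Sl]] := noetherian_regular (S := fun x => exists2 v, S v & v 0 k' = x).
  split=> [|a _ _ [u Su <-] [v Sv <-]]; first by exists 0; [case: SS|rewrite mxE].
  by exists (a *: u + v); [apply: SS.2|rewrite !mxE].
have [|v Sv i ki|s [sS Ss]] := IH (fun v => S v /\ v 0 k' = 0).
- split=> [|a u v [Su u0] [Sv v0]]; first by split; [case: SS|rewrite mxE].
  by split; [apply: SS.2|rewrite !mxE u0 v0 mulr0 addr0].
- have [eqki|neki] := eqVneq (k : nat) i.
    by have -> : i = k' by [apply: val_inj]; case: Sv.
  by apply: S0 Sv.1 _ _; rewrite ltn_neqAle neki.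
have [f fP] : exists f : R -> 'rV[R]_n, forall x, x \in l -> S (f x) /\ f x 0 k' = x.
  have [x|f fP] := choice (P := fun x v => x \in l -> S v /\ v 0 k' = x).
    have [/lS[v Sv vx]|nl] := boolP (x \in l); last by exists 0.
    by exists v.
  by exists f.
exists (map f l ++ s); split=> [v|v Sv].
  by rewrite mem_cat => /orP[/mapP[x /fP[Sx _] ->]|/sS[]].
have SG := module_span_submodule (fun w => w \in map f l ++ s).
suff [w [Sw Gw wv]] : exists w, [/\ S w, module_span (fun w => w \in map f l ++ s) w
    & w 0 k' = v 0 k'].
  rewrite -[v](subrK w); apply: submoduleD Gw => //.
  apply: (module_spanS (G := fun w => w \in s)) => [x xs|].
    by rewrite mem_cat xs orbT.
  by apply: Ss; split; [exact: submoduleB|rewrite !mxE wv subrr].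
have : module_span (fun w => w \in l) (v 0 k' : R^o) by apply: Sl; exists v.
move: (v 0 k'); apply: (@module_span_min _ R^o) => [|x xl].
  split; first by exists 0; split; [case: SS|case: SG|rewrite mxE].
  move=> a x y [u [Su Gu <-]] [w [Sw Gw <-]]; exists (a *: u + w).
  by split; [apply: SS.2|apply: SG.2|rewrite !mxE].
have [Sx fx] := fP x xl; exists (f x); split=> //.
by apply: sub_module_span; rewrite mem_cat map_f.
Qed.

End Ideals.

(** * Primes and primary ideals *)

Section Primes.
Variable R : comNzRingType.
Hypothesis noethR : noetherian R.
Implicit Types (I J Q : R^o -> Prop) (x y : R).

Notation ideal := (@submodule R R^o).

Definition adjoin I x : R^o -> Prop := fun z => exists a : R, I (z - a * x).

Lemma adjoin_ideal I x : ideal I -> ideal (adjoin I x).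
Proof.
move=> II; split=> [|a u v [b Ib] [c Ic]]; first by exists 0; rewrite mul0r subr0; case: II.
exists (a * b + c); have -> : a *: u + v - (a * b + c) * x =
    a *: (u - b * x : R^o) + (v - c * x) :> R^o.
  by rewrite /GRing.scale /= mulrDl mulrBr mulrA opprD addrACA.
exact: II.2.
Qed.

Lemma sub_adjoin I x z : I z -> adjoin I x z.
Proof. by exists 0; rewrite mul0r subr0. Qed.

Lemma mem_adjoin I x : ideal I -> adjoin I x x.
Proof. by exists 1; rewrite mul1r subrr; case: H. Qed.

(** An ideal [Q] maximal among those that contain [I] and miss [M] is prime: if [x] and [y] are
    outside [Q], both [Q + R x] and [Q + R y] meet [M], and [x y] in [Q] would put the product of
    the two common elements into [Q]. *)
Lemma prime_disjoint I (M : R -> Prop) : ideal I -> M 1 ->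
    (forall x y, M x -> M y -> M (x * y)) -> (forall x, M x -> ~ I x) ->
  exists Q, [/\ prime_ideal Q, forall x, I x -> Q x & forall x, M x -> ~ Q x].
Proof.
move=> II M1 MM MI.
pose Phi J := (forall x, I x -> J x) /\ forall x, M x -> ~ J x.
have [Q [QI [IQ MQ] Qmax]] :=
  noetherian_max (noetherian_regular noethR) II (conj (fun=> id) MI : Phi I).
exists Q; split=> //; split=> [//||x y Qxy]; first exact: MQ.
have meet z : ~ Q z -> exists2 a, M a & adjoin Q z a.
  move=> nQz; apply: contrapT => noM; apply: nQz.
  apply: (Qmax (adjoin Q z)); last exact: mem_adjoin.
  - exact: adjoin_ideal.
  - split=> [w /IQ|w Mw Qw]; first exact: sub_adjoin.
    by apply: noM; exists w.
  - by move=> w; apply: sub_adjoin.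
apply: contrapT => /not_orP[/meet[a Ma [b Qb]] /meet[c Mc [d Qd]]].
apply: (MQ _ (MM _ _ Ma Mc)).
have -> : a * c = a * (c - d * y) + (d * y * (a - b * x) + d * b * (x * y)).
  by ring.
by apply: (submoduleD QI); [|apply: (submoduleD QI)]; apply: (ideal_mull _ QI).
Qed.

Definition regular_mod I x : Prop := forall t, I (t * x) -> I t.

Definition radical_ideal I : Prop := forall x, I (x * x) -> I x.

(* Adding to [c] an element [t] of its annihilator shrinks the annihilator;
   the noetherian property is applied to the double annihilators. *)
Lemma regular_mod_exists I r : ideal I -> radical_ideal I -> ~ I r ->
  exists s, I (r * s) /\ regular_mod I (r + s).
Proof.
move=> II radI nIr.
pose annann c : R^o -> Prop := fun z => forall t, I (t * c) -> I (z * t).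
have annannI c : ideal (annann c).
  split=> [t _|a u v au av t tc]; first by rewrite mul0r; case: II.
  by rewrite mulrDl -mulrA; apply: II.2; [apply: au|apply: av].
pose Phi (S : R^o -> Prop) := exists2 s, I (r * s) & S = annann (r + s).
have [|S [_ [s Irs ->] Smax]] := noetherian_max (noetherian_regular noethR)
    (annannI (r + 0)) (Phi := Phi).
  by exists 0 => //; rewrite mulr0; case: II.
exists s; split=> // t Itc; apply: contrapT => nIt; apply: nIt.
set c := r + s in Smax Itc.
(* The square of [t r] is [t r (t c) - t t (r s)], and [I] is radical. *)
have Itr : I (t * r).
  have Itr2 : I (t * r * (t * c) - t * t * (r * s)).
    by apply: (submoduleB II); apply: ideal_mull.
  apply: radI; move: Itr2; congr I; rewrite /c; ring.
have Icc x : I (x * (c + t)) -> I (x * t).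
  move=> Ix; apply: radI; rewrite mulrACA.
  have -> : x * x * (t * t) = t * x * (x * (c + t)) - x * x * (t * c).
    by ring.
  by apply: (submoduleB II); apply: ideal_mull.
(* By [Icc], [t] lies in the double annihilator of [c + t], which contains that of [c]. By
   maximality it lies in the latter, and [t c] in [I] then gives [t t] in [I]. *)
apply: (radI); apply: (Smax (annann (r + (s + t)))) => //.
- exists (s + t) => //; rewrite mulrDr; apply: submoduleD => //.
  by rewrite mulrC.
- move=> z zc x; rewrite addrA -/c => Ix; apply: zc.
  by rewrite -[x * c](addrK (x * t)) -mulrDr; apply: (submoduleB II) (Icc _ Ix).
- by move=> x; rewrite addrA -/c => /Icc; rewrite mulrC.
Qed.

(** The products [t * x ^+ n] with [t] outside [Q] form a multiplicative set, which misses [I]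
    because [x] is regular modulo [I]. A prime over [I] that avoids this set lies inside [Q] and
    does not contain [x]. *)
Lemma prime_below I Q x : ideal I -> regular_mod I x ->
    prime_ideal Q -> (forall z, I z -> Q z) ->
  exists Q', [/\ prime_ideal Q', forall z, I z -> Q' z,
    forall z, Q' z -> Q z & ~ Q' x].
Proof.
move=> II regx [QI Q1 QP] IQ.
pose M z := exists n t, ~ Q t /\ z = t * x ^+ n.
have [||z [n [t [nQt ->]]]|Q' [Q'P IQ' MQ']] := prime_disjoint (M := M) II.
- by exists 0%N, 1; rewrite mulr1.
- move=> _ _ [i [s [nQs ->]]] [j [t [nQt ->]]]; exists (i + j)%N, (s * t).
  by rewrite mulrACA exprD; split=> // /QP[].
- elim: n => [|n IH]; first by rewrite mulr1 => /IQ.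
  by rewrite exprSr mulrA => /regx.
exists Q'; split=> // [z Q'z|].
  apply: contrapT => nQz; apply: (MQ' z) => //.
  by exists 0%N, z; rewrite mulr1.
by apply: MQ'; exists 1%N, 1; rewrite mul1r expr1.
Qed.

Section Local.
Variable m : idealr R.
Hypothesis locR : local_ring m.

(** The noetherian property replaces Zorn's lemma: an ideal maximal among the proper ones over [I]
    is a maximal ideal, hence [m]. *)
Lemma proper_sub_max I : ideal I -> ~ I 1 -> forall x, I x -> x \in m.
Proof.
move=> II I1 x Ix.
pose Phi J := (forall x, I x -> J x) /\ ~ J 1.
have [Q [QI [IQ Q1] Qmax]] :=
  noetherian_max (noetherian_regular noethR) II (conj (fun=> id) I1 : Phi I).
have [J JP] := ideal_idealr QI Q1.
suff /locR.2 <- : maximal_ideal J by apply/JP/IQ.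
move=> J' JJ' z; apply/idP/idP => [J'z|/JJ'//]; apply/JP.
apply: (Qmax (fun x => x \in J')) J'z; first exact: idealr_ideal.
  by split=> [w /IQ/JP/JJ'//|]; rewrite idealr1.
by move=> w /JP/JJ'.
Qed.

Lemma local_unit x : x \notin m -> exists y, y * x = 1.
Proof.
move=> nmx; apply: contrapT => noinv; case/negP: nmx.
have SI : ideal (fun z => exists y, z = y * x).
  split=> [|a _ _ [b ->] [c ->]]; first by exists 0; rewrite mul0r.
  by exists (a * b + c); rewrite /GRing.scale /= mulrDl mulrA.
apply: (proper_sub_max SI); last by exists 1; rewrite mul1r.
by case=> y xy; apply: noinv; exists y.
Qed.

Lemma max_prime : prime_ideal (fun x => x \in m).
Proof.
split; [exact: idealr_ideal|by rewrite idealr1|].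
move=> x y mxy; apply: contrapT => /not_orP[/negP/local_unit[a ax] /negP/local_unit[b yb]].
suff : 1 \in m by rewrite idealr1.
by rewrite -(mulr1 1) -{1}ax -yb mulrACA idealMr.
Qed.

Definition primary I : Prop := forall x, x \in m -> exists k, I (x ^+ k).

(** Take [y] outside [J] with [(J : y)] maximal. If [z y] were outside [J] for some [z] in [m],
    maximality would keep every [z ^+ n * y] outside [J], although a power of [z] is in [J]. *)
Lemma primary_socle J : ideal J -> primary J -> ~ J 1 ->
  exists2 x, ~ J x & forall z, z \in m -> J (z * x).
Proof.
move=> JI Jm J1.
pose quo y : R^o -> Prop := fun z => J (z * y).
have quoI y : ideal (quo y).
  split=> [|a u v au av]; first by rewrite /quo mul0r; case: JI.
  by rewrite /quo mulrDl -mulrA; apply: JI.2.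
pose Phi (S : R^o -> Prop) := exists2 y, ~ J y & S = quo y.
have [|S [_ [y nJy ->] Smax]] := noetherian_max (noetherian_regular noethR)
    (quoI 1) (Phi := Phi); first by exists 1.
exists y => // z mz; apply: contrapT => nJzy.
have [k Jk] := Jm z mz.
suff nJ n : ~ J (z ^+ n * y) by apply: (nJ k); apply: ideal_mulr.
elim: n => [|n IH]; first by rewrite mul1r.
rewrite exprS -mulrA => Jn; apply: nJzy.
apply: (Smax (quo (z ^+ n * y))) => //; first by exists (z ^+ n * y).
by move=> w; rewrite /quo mulrCA; apply: ideal_mull.
Qed.

Lemma primaryS I J : (forall x, I x -> J x) -> primary I -> primary J.
Proof. by move=> IJ Im x /Im[k /IJ]; exists k. Qed.

(** This replaces induction on the length of [R/J]: each step enlarges [J] by a socle element of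
    [R/J], and the noetherian property makes the process stop at the unit ideal. *)
Lemma primary_ind (Phi : (R^o -> Prop) -> Prop) :
    (forall J, ideal J -> J 1 -> Phi J) ->
    (forall J x, ideal J -> primary J -> ~ J x -> (forall z, z \in m -> J (z * x)) ->
      Phi (adjoin J x) -> Phi J) ->
  forall J, ideal J -> primary J -> Phi J.
Proof.
move=> Phi1 PhiS J JI Jm; apply: contrapT => nPhi.
have [S [SI [Sm nPS] Smax]] := noetherian_max (noetherian_regular noethR) JI
  (Phi := fun J => primary J /\ ~ Phi J) (conj Jm nPhi).
have [S1|S1] := pselect (S 1); first by apply: nPS; apply: Phi1.
have [x nSx mx] := primary_socle SI Sm S1.
apply: nPS; apply: PhiS mx _ => //; apply: contrapT => nPA; apply: nSx.
have leA z := @sub_adjoin S x z.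
apply: (Smax (adjoin S x)) (mem_adjoin _ _) => //; first exact: adjoin_ideal.
by split=> //; apply: primaryS Sm.
Qed.

(** * Chains of primes and parameters modulo a prime *)

Section Chains.
Variable P : R^o -> Prop.
Hypothesis primeP : prime_ideal P.

(** The recursion descends from the top prime [Q], the direction in which [prime_below] produces
    primes. The lowest prime contains [P] and may differ from it. *)
Fixpoint chain_to (n : nat) Q : Prop :=
  [/\ prime_ideal Q, forall x, P x -> Q x &
    if n is n'.+1 then exists2 Q', chain_to n' Q' &
      (forall x, Q' x -> Q x) /\ exists2 x, Q x & ~ Q' x else True].

Definition extend (xs : seq R) : R^o -> Prop :=
  module_span (fun y : R^o => P y \/ y \in xs).

(** Elements of [m] are added one at a time, each regular modulo the radical of the ideal generated
    by [P] and the earlier ones. Every prime over the longer list then strictly contains a prime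
    over the shorter one. The construction stops early only when that radical contains [m]. *)
Lemma chain_or_primary n : chain_to n (fun x => x \in m) \/
  exists xs : seq R, [/\ (size xs < n)%N, forall x, x \in xs -> x \in m
    & primary (extend xs)].
Proof.
have Pm x : P x -> x \in m by move: x; case: primeP => PI P1 _; apply: proper_sub_max.
(* For the induction the chain is asked below every prime that contains [P] and [xs]; the case of
   [m] is used at the end. *)
suff : (exists xs : seq R, [/\ size xs = n, forall x, x \in xs -> x \in m &
      forall Q, prime_ideal Q -> (forall x, P x -> Q x) ->
        (forall x, x \in xs -> Q x) -> chain_to n Q]) \/
    exists xs : seq R, [/\ (size xs < n)%N, forall x, x \in xs -> x \in m
      & primary (extend xs)].
  case=> [[xs [_ xsm /(_ _ max_prime)]]|]; last by right.
  by move=> /(_ Pm xsm); left.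
elim: n => [|n [[xs [xsn xsm xsQ]]|[xs [xsn xsm xsP]]]].
- by left; exists [::].
- pose I : R^o -> Prop := fun z => forall Q, prime_ideal Q ->
    (forall x, P x -> Q x) -> (forall x, x \in xs -> Q x) -> Q z.
  have II : ideal I.
    split=> [Q [QI _ _] _ _|a u v Iu Iv Q QP PQ xQ]; first by case: QI.
    by have [QI _ _] := QP; apply: QI.2; [apply: Iu|apply: Iv].
  have radI : radical_ideal I.
    by move=> x Ix Q QP PQ xQ; have [_ _ Qx] := QP; case: (Qx x x) => //; apply: Ix.
  have [mI|/existsNP[r /not_implyP[mr nIr]]] := pselect (forall x, x \in m -> I x).
    right; exists xs; split=> [|//|x mx]; first by rewrite xsn.
    (* If no power of [x] were in [extend P xs], a prime over this ideal would avoid the powers of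
       [x], although it contains [I] and hence [m]. *)
    apply: contrapT => noJ.
    have [|_ _ [i ->] [j ->]|_ [i ->] Jx|Q [QP JQ MQ]] := prime_disjoint
      (module_span_submodule (fun y : R^o => P y \/ y \in xs))
      (M := fun z => exists n, z = x ^+ n).
    - by exists 0%N.
    - by exists (i + j)%N; rewrite exprD.
    - by apply: noJ; exists i.
    - case: (MQ x); first by exists 1%N.
      by apply: mI => // z zP; apply: JQ; apply: sub_module_span; [left|right].
  left; have [s [Irs regc]] := regular_mod_exists II radI nIr.
  (* Were [s] a unit, [r s] in [I] would give [r] in [I]. So the new element [r + s] belongs to
     [m]. *)
  have ms : s \in m.
    apply: contrapT => /negP/local_unit[t ts]; apply: nIr.
    by rewrite -[r]mulr1 -ts mulrCA; apply: (ideal_mull _ II).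
  exists (r + s :: xs); split=> /=; first by rewrite xsn.
    by move=> x; rewrite inE => /predU1P[->|/xsm//]; rewrite rpredD.
  move=> Q QP PQ xQ; split=> //.
  have [|Q' [Q'P IQ' Q'Q nQ']] := prime_below II regc QP.
    by move=> z; apply=> // x xs'; apply: xQ; rewrite inE xs' orbT.
  exists Q'; last by split=> //; exists (r + s) => //; apply: xQ; rewrite mem_head.
  apply: xsQ => // x xP; apply: IQ' => Q'' _ PQ'' xQ''; [exact: PQ''|exact: xQ''].
- by right; exists xs; split=> //; apply: ltnW.
Qed.

End Chains.
End Local.
End Primes.

(** * The injective hull of the residue field *)

Section Hull.
Variables (R : comNzRingType) (m : idealr R).
Hypothesis noethR : noetherian R.
Hypothesis locR : local_ring m.

Notation ideal := (@submodule R R^o).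

(** The cyclic submodule [R x] is realized as [R] modulo the annihilator of [x]; sending the class
    of 1 to [e] is well defined there, and injectivity extends this map to [M]. *)
Lemma injective_extend (E M : lmodType R) (x : M) (e : E) :
    injective_module E -> (forall r : R, r *: x = 0 -> r *: e = 0) ->
  exists h : {linear M -> E}, h x = e.
Proof.
move=> injE annxe.
pose ann : R^o -> Prop := fun r => (r : R) *: x = 0.
have annI : submodule ann.
  split=> [|a r s ar as_]; first exact: scale0r.
  by rewrite /ann scalerDl -scalerA ar as_ scaler0 addr0.
pose S := span_submod ann.
have SP (r : R^o) : r \in S <-> (r : R) *: x = 0 by exact: mem_span_submodule.
pose f (z : modquot S) : M := (mod_repr z : R) *: x.
pose g (z : modquot S) : E := (mod_repr z : R) *: e.
have reprP (a : R) (z w : modquot S) :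
    (a * (mod_repr z : R) + mod_repr w - mod_repr (a *: z + w) : R) *: x = 0.
  apply/(SP (a *: mod_repr z + mod_repr w - mod_repr (a *: z + w) : R^o))/mod_piP.
  by rewrite mod_reprK linearP /= !mod_reprK.
have fL : linear f.
  move=> a z w; apply/esym/eqP; rewrite -subr_eq0 /f scalerA -scalerDl -scalerBl.
  by rewrite reprP.
have gL : linear g.
  move=> a z w; apply/esym/eqP; rewrite -subr_eq0 /g scalerA -scalerDl -scalerBl.
  by rewrite (annxe _ (reprP a z w)).
pose f' : {linear modquot S -> M} := HB.pack f (GRing.isLinear.Build R _ _ _ f fL).
pose g' : {linear modquot S -> E} := HB.pack g (GRing.isLinear.Build R _ _ _ g gL).
have [|h hP] := injE _ _ f' g'.
  move=> z w /eqP; rewrite -subr_eq0 /= /f -scalerBl => /eqP/SP/mod_piP.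
  by rewrite !mod_reprK.
exists h; have [fE gE] : f (mod_pi S 1) = x /\ g (mod_pi S 1) = e.
  have P1 : (mod_repr (mod_pi S (1 : R^o)) - 1 : R) *: x = 0.
    by apply/SP/mod_piP; rewrite mod_reprK.
  have /eqP := annxe _ P1; move/eqP: P1; rewrite !scalerBl !scale1r !subr_eq0.
  by move=> /eqP fE /eqP gE; split.
by rewrite -[in LHS]fE -gE; exact: hP.
Qed.

Variables (E : lmodType R) (u : E).
Hypothesis injE : injective_module E.
Hypothesis u_neq0 : u <> 0.
Hypothesis u_gen : socle_generator m u.

Lemma socle_gen r : r \in m -> r *: u = 0.
Proof. by move: r; apply/(u_gen u); exists 1; rewrite scale1r. Qed.

Lemma nunit_max r : ~ (exists y, y * r = 1) -> r \in m.
Proof. by move=> nr; apply: contrapT => /negP/(local_unit noethR locR). Qed.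

Lemma cyclic_to_socle (M : lmodType R) (x : M) :
  (forall r, r *: x = 0 -> r \in m) -> exists h : {linear M -> E}, h x = u.
Proof. by move=> xm; apply: injective_extend => // r /xm/socle_gen. Qed.

(** The class of [s] in [R/I] is nonzero, so its annihilator lies in [m] and some map from [R/I] to
    [E] sends it to [u]. The image of 1 is the required [y]. *)
Lemma hull_faithful (I : R^o -> Prop) s : ideal I -> ~ I s ->
  exists y : E, (forall c, I c -> c *: y = 0) /\ s *: y <> 0.
Proof.
move=> II nIs; pose S := span_submod I.
have SP (r : R^o) : r \in S <-> I r by exact: mem_span_submodule.
have pi0 (r : R^o) : mod_pi S r = 0 <-> I r.
  by rewrite -(SP r) -[in r \in S](subr0 r) -mod_piP linear0.
have [|h hP] := @cyclic_to_socle (modquot S) (mod_pi S (s : R^o)).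
  move=> r; rewrite -linearZ /= => /pi0 Irs; apply: nunit_max => -[y yr].
  by apply: nIs; rewrite -[s]mul1r -yr -mulrA; apply: (ideal_mull _ II).
have hE r : r *: h (mod_pi S (1 : R^o)) = h (mod_pi S (r : R^o)).
  by rewrite -!linearZ /=; congr (h (mod_pi S _)); exact: mulr1.
exists (h (mod_pi S (1 : R^o))); split=> [c|]; rewrite hE ?hP //.
by move=> /pi0->; rewrite linear0.
Qed.

Definition annihilated (I : R^o -> Prop) (y : E) := forall c : R, I c -> c *: y = 0.

(** A piece of Matlis duality that avoids the completion of [R]. If [psi] is multiplication by [r]
    on the elements killed by [J + R x], then on those killed by [J] the difference [phi] depends
    only on [x *: y]. As [m x] lies in [J], this element lies in the socle [R u], so that one [y0]
    with [x *: y0] nonzero determines [phi]. *)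
Lemma hull_endo (J : R^o -> Prop) : ideal J -> primary m J ->
  forall psi : {linear E -> E}, exists r : R,
    forall y, annihilated J y -> psi y = r *: y.
Proof.
move: J; apply: (primary_ind noethR) => [J JI J1 psi|J x JI Jm nJx mx IH psi].
  by exists 0 => y /(_ 1 J1); rewrite scale1r => ->; rewrite linear0 scale0r.
have [r rP] := IH psi; pose phi y := psi y - r *: y.
have phiL a y z : phi (a *: y + z) = a *: phi y + phi z.
  rewrite /phi linearP /= scalerDr scalerBr !scalerA mulrC opprD.
  by rewrite addrACA.
have phiZ a y : phi (a *: y) = a *: phi y.
  have phi00 : phi 0 = 0 by rewrite /phi linear0 scaler0 subrr.
  by rewrite -[a *: y]addr0 phiL phi00 addr0.
have phi0 y : annihilated J y -> x *: y = 0 -> phi y = 0.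
  move=> Jy xy; rewrite /phi rP ?subrr // => c [a Jc].
  by rewrite -[c](subrK (a * x)) scalerDl (Jy _ Jc) -scalerA xy scaler0 addr0.
suff [s sP] : exists s : R, forall y, annihilated J y -> phi y = s *: (x *: y).
  exists (r + s * x) => y Jy; rewrite scalerDl -scalerA -sP //.
  by rewrite /phi addrC subrK.
have [[y0 [Jy0 xy0]]|no] := pselect (exists y, annihilated J y /\ x *: y <> 0); last first.
  exists 0 => y Jy; rewrite scale0r; apply: phi0 => //.
  by apply: contrapT => xy; apply: no; exists y.
have xsoc y : annihilated J y -> exists c, x *: y = c *: u.
  move=> Jy; apply/(u_gen (x *: y)) => c mc; rewrite scalerA.
  by apply: Jy; apply: mx.
have [r0 r0E] := xsoc _ Jy0.
have [t tr0] : exists t, t * r0 = 1.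
  apply: contrapT => /nunit_max mr0; apply: xy0.
  by rewrite r0E socle_gen.
have uE : u = t *: (x *: y0) by rewrite r0E scalerA tr0 scale1r.
have [r1 r1E] : exists c, phi y0 = c *: u.
  apply/(u_gen (phi y0)) => c mc; rewrite -phiZ; apply: phi0.
    by move=> d Jd; rewrite scalerA mulrC -scalerA (Jy0 _ Jd) scaler0.
  by rewrite scalerA mulrC Jy0 //; apply: mx.
exists (r1 * t) => y Jy; have [r2 r2E] := xsoc _ Jy.
(* Since [x *: y] is [r2 *: u] and [u] is [t *: (x *: y0)], this combination is killed by [x], and
   [phi] vanishes on it. *)
have := phi0 (- (r2 * t) *: y0 + y).
rewrite phiL scaleNr => phiE; apply/eqP; rewrite -subr_eq0; apply/eqP.
rewrite -[RHS]phiE => [|c Jc|].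
- by rewrite r1E r2E !scalerA [LHS]addrC -scaleNr; congr (_ *: _ + _); ring.
- rewrite scalerDr (Jy _ Jc) addr0 scalerN scalerA mulrC -scalerA (Jy0 _ Jc).
  by rewrite scaler0 oppr0.
- rewrite scalerDr r2E [in X in _ + X]uE scalerN !scalerA.
  by rewrite [x * _]mulrC addNr.
Qed.

End Hull.

(** * Splittings detected by the tensor product with the hull *)

Section Splitting.
Variables (R : comNzRingType) (m : idealr R).
Hypothesis noethR : noetherian R.
Hypothesis locR : local_ring m.

Notation ideal := (@submodule R R^o).

(* A weak form of the Artin-Rees lemma, to be used with [L0 = m L]. *)
Lemma artin_rees (V : lmodType R) (L L0 : V -> Prop) :
    noetherian_module V -> submodule L -> submodule L0 ->
    (forall x v, x \in m -> L v -> L0 (x *: v)) ->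
  exists T, [/\ submodule T, forall v, T v -> L v -> L0 v &
    forall x, x \in m -> exists k, forall v, T (x ^+ k *: v)].
Proof.
move=> noethV LS L0S mL.
pose Phi T := (forall v, L0 v -> T v) /\ forall v, T v -> L v -> L0 v.
have [T [TS [L0T TL] Tmax]] := noetherian_max noethV L0S
  (conj (fun _ => id) (fun _ L0v _ => L0v) : Phi L0).
exists T; split=> // x mx.
pose quo k v := T (x ^+ k *: v).
have quoS k : submodule (quo k).
  split=> [|a u v Tu Tv]; first by rewrite /quo scaler0; case: TS.
  by rewrite /quo scalerDr scalerA mulrC -scalerA; apply: TS.2.
pose Psi (S : V -> Prop) := exists k, S = quo k.
have [|_ [_ [k ->] kmax]] := noetherian_max noethV (quoS 0%N) (Phi := Psi).
  by exists 0%N.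
(* The preimages of [T] under the powers of [x] increase; [k] is an exponent where they have become
   stationary. *)
have stab v : T (x ^+ k.+1 *: v) -> T (x ^+ k *: v).
  apply: (kmax (quo k.+1)); [exact: quoS|by exists k.+1|] => w Tw.
  by rewrite /quo exprS -scalerA; apply: submoduleZ.
exists k => f; apply: (Tmax (fun w => exists f, T (w - x ^+ k *: f))).
- split=> [|a v w [g Tg] [h Th]]; first by exists 0; rewrite scaler0 subr0; case: TS.
  exists (a *: g + h); rewrite scalerDr opprD addrACA scalerA mulrC -scalerA.
  by rewrite -scalerBr; apply: TS.2.
- split=> [v /L0T Tv|v [g Tg] Lv]; first by exists 0; rewrite scaler0 subr0.
  apply: TL => //; rewrite -[v](subrK (x ^+ k *: g)); apply: submoduleD => //.
  apply: stab; rewrite exprS -scalerA -[x ^+ k *: g](subKr v) scalerBr.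
  by apply: submoduleB => //; [apply: L0T; apply: mL|apply: submoduleZ].
- by move=> v Tv; exists 0; rewrite scaler0 subr0.
- by exists f; rewrite subrr; case: TS.
Qed.

Variables (E : lmodType R) (u : E).
Hypothesis injE : injective_module E.
Hypothesis u_neq0 : u <> 0.
Hypothesis u_gen : socle_generator m u.

Lemma tens0l (N M : lmodType R) (y : M) : tens (0 : N) y = 0.
Proof. by rewrite -(scale0r (0 : N)) tensZl scale0r. Qed.

Lemma tens_suml (N M : lmodType R) (y : M) I (r : seq I) (F : I -> N) :
  tens (\sum_(i <- r) F i) y = \sum_(i <- r) tens (F i) y.
Proof.
by elim/big_rec2: _ => [|i x z _ <-]; [exact: tens0l|rewrite tensDl].
Qed.

(** A map [phi] from the tensor product to [E] sends [tens x u] to [u]. On each generator of [N] it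
    induces an endomorphism of [E], which is multiplication by some [r i] on the elements killed by
    a primary ideal [I]. The vector of the [r i] respects the relations of [N] modulo [I];
    [artin_rees] corrects it by a vector with entries in [m], so that it respects them exactly and
    defines a linear form on [N] with a unit value at [x]. *)
Lemma tensor_splitting (N : lmodType R) (x : N) :
  finite_module N -> tens x u <> 0 -> exists g : {linear N -> R^o}, g x = 1.
Proof.
move=> [s sN] xu; pose a := size s.
pose comb (v : 'rV[R]_a) := \sum_i v 0 i *: s`_i.
have combL c v w : comb (c *: v + w) = c *: comb v + comb w.
  rewrite /comb scaler_sumr -big_split; apply: eq_bigr => i _ /=.
  by rewrite !mxE scalerDl scalerA.
have comb0 : comb 0 = 0 by rewrite /comb big1 // => i _; rewrite mxE scale0r.
have [|t [tK Kt]] := noetherian_rV noethR (S := fun v => comb v = 0).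
  by split=> // c v w v0 w0; rewrite combL v0 w0 scaler0 addr0.
(* The columns of [B] generate the relations between the generators [s]. A row vector defines a
   linear form on [N] when its product with [B] is zero. *)
pose b := size t; pose B : 'M[R]_(a, b) := \matrix_(i, j) (t`_j) 0 i.
pose L (w : 'rV[R]_b) := exists v, w = v *m B.
pose L0 (w : 'rV[R]_b) := exists2 v : 'rV_a, forall i, v 0 i \in m & w = v *m B.
have [|||T [TS TL Tm]] := @artin_rees 'rV[R]_b L L0 (@noetherian_rV R noethR b).
- split=> [|c _ _ [v ->] [w ->]]; first by exists 0; rewrite mul0mx.
  by exists (c *: v + w); rewrite mulmxDl scalemxAl.
- split=> [|c _ _ [v vm ->] [w wm ->]].
    by exists 0; rewrite ?mul0mx // => i; rewrite mxE idealr0.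
  exists (c *: v + w); last by rewrite mulmxDl scalemxAl.
  by move=> i; rewrite !mxE rpredD // idealMr.
- move=> c _ mc [v ->]; exists (c *: v); last by rewrite scalemxAl.
  by move=> i; rewrite mxE mulrC idealMr.
(* Vectors with entries in [I] lie in [T]. The condition [c \in m] ensures that [I] kills [u]. *)
pose I (c : R^o) := (c : R) \in m /\ forall f : 'rV_b, T ((c : R) *: f).
have II : ideal I.
  split=> [|c v w [mv Tv] [mw Tw]].
    by split=> [|f]; [exact: idealr0|rewrite scale0r; case: TS].
  split=> [|f]; first by rewrite rpredD // idealMr.
  by rewrite scalerDl -scalerA; apply: TS.2.
have Im : primary m I.
  move=> c mc; have [k Tk] := Tm c mc; exists k.+1.
  split=> [|f]; first by rewrite exprS mulrC idealMr.
  by rewrite exprS -scalerA; apply: submoduleZ.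
have [|phi phix] := @cyclic_to_socle R m E u injE u_gen (tensor N E) (tens x u).
  move=> r xr; apply: (nunit_max noethR locR) => -[y yr]; apply: xu.
  by rewrite -[LHS]scale1r -yr -scalerA xr scaler0.
have /choice[r rP] (i : 'I_a) : exists r, forall y, annihilated I y ->
    phi (tens s`_i y) = r *: y.
  pose psi y := phi (tens s`_i y).
  have psiL : linear psi by move=> c y z; rewrite /psi tensDr tensZr linearP.
  pose psi' : {linear E -> E} := HB.pack psi (GRing.isLinear.Build R _ _ _ psi psiL).
  exact: (hull_endo noethR locR u_gen II Im psi').
have phi_comb c y : annihilated I y -> phi (tens (comb c) y) = (\sum_i c 0 i * r i) *: y.
  move=> Iy; rewrite tens_suml linear_sum scaler_suml; apply: eq_bigr => i _.
  by rewrite tensZl linearZ /= rP // scalerA.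
pose v := \row_i r i.
(* This entry acts on every [y] killed by [I] as [phi (tens 0 y)], hence as zero, and
   [hull_faithful] puts it into [I]. *)
have vB j : I ((v *m B) 0 j).
  apply: contrapT => nI.
  have [y [Iy]] := hull_faithful noethR locR injE u_neq0 u_gen II nI; apply.
  have <- : phi (tens (comb t`_j) y) = (v *m B) 0 j *: y.
    rewrite phi_comb //; congr (_ *: _); rewrite mxE; apply: eq_bigr => i _.
    by rewrite !mxE mulrC.
  by rewrite tK ?mem_nth // tens0l linear0.
have [w wm wB] : L0 (v *m B).
  apply: TL; last by exists v.
  rewrite [v *m B]row_sum_delta; apply: submodule_sum => // j _.
  exact: (vB j).2.
have v'B : (v - w) *m B = 0 by rewrite mulmxBl wB subrr.
pose dot (c : 'rV[R]_a) := \sum_i c 0 i * (v - w) 0 i.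
have dotL c d e : dot (c *: d + e) = c * dot d + dot e.
  rewrite /dot mulr_sumr -big_split; apply: eq_bigr => i _ /=.
  by rewrite !mxE mulrDl mulrA.
have dotK c : comb c = 0 -> dot c = 0.
  move=> /Kt; move: c; apply: module_span_min => [|c /(nthP 0)[j ltj <-]].
    split=> [|c d e d0 e0]; last by rewrite dotL d0 e0 mulr0 addr0.
    by rewrite /dot big1 // => i _; rewrite mxE mul0r.
  have /rowP/(_ (Ordinal ltj)) := v'B; rewrite [LHS]mxE [X in _ = X]mxE => <-.
  by apply: eq_bigr => i _; rewrite [B _ _]mxE mulrC.
have /choice[c cP] y : exists c, y = comb c by apply: module_span_nth.
have dotE d e : comb d = comb e -> dot d = dot e.
  move=> de; apply/eqP; rewrite -subr_eq0 -mulN1r addrC -dotL.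
  by apply/eqP/dotK; rewrite combL de scaleN1r addNr.
(* The form given by [v] acts on [u] as [phi (tens x u) = u], so its value at [x] is 1 modulo [m];
   the correction [w] changes this value only by an element of [m]. *)
have mg : dot (c x) \notin m.
  apply/negP => mdot; have := phi_comb (c x) u.
  rewrite -cP phix => /(_ _)/eqP; rewrite -subr_eq0 -[X in X - _]scale1r -scalerBl.
  set d := 1 - _ => du.
  have md : d \in m.
    apply: (nunit_max noethR locR) => -[y yd]; apply: u_neq0.
    rewrite -[u]scale1r -yd -scalerA; apply/eqP.
    rewrite (eqP (du _)) ?scaler0 // => e [me _]; exact: socle_gen u_gen _ me.
  suff : 1 \in m by rewrite idealr1.
  rewrite -[1](subrK (\sum_i c x 0 i * r i)) rpredD //.
  have -> : \sum_i c x 0 i * r i = dot (c x) + \sum_i c x 0 i * w 0 i.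
    by rewrite -big_split; apply: eq_bigr => i _ /=; rewrite !mxE -mulrDr subrK.
  by rewrite rpredD // rpred_sum // => i _; rewrite idealMr.
have [z zdot] := local_unit noethR locR mg.
pose g (y : N) : R^o := z * dot (c y).
have gL : linear g.
  move=> d y y'; rewrite /g (_ : dot _ = d * dot (c y) + dot (c y')).
    by rewrite mulrDr mulrCA.
  by rewrite -dotL; apply: dotE; rewrite combL -!cP.
pose g' : {linear N -> R^o} := HB.pack g (GRing.isLinear.Build R _ _ _ g gL).
by exists g'; rewrite /= /g zdot.
Qed.

Lemma splitting_tensor (N : lmodType R) (x : N) (g : {linear N -> R^o}) :
  g x = 1 -> tens x u <> 0.
Proof.
move=> gx xu; apply: u_neq0.
pose h (n : N) (y : E) := (g n : R) *: y.
have hB : bilinear_map h.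
  split=> [y c n n'|n c y y']; rewrite /h.
    by rewrite linearP scalerDl scalerA.
  by rewrite scalerDr !scalerA mulrC.
have := tensor_lift_tens x u hB.
rewrite xu /h gx scale1r => <-.
have L := tensor_lift_linear hB; have := L (-1) 0 0.
by rewrite scaler0 addr0 scaleN1r addNr.
Qed.

End Splitting.

(** * Cartier maps and the splitting prime *)

Section IdealQuotient.
Variables (R : comNzRingType) (I : idealr R).

Lemma ideal_quot_eq (x y : R) :
  \pi_{ideal_quot I} x = \pi_{ideal_quot I} y <-> x - y \in I.
Proof. by rewrite Quotient.idealrBE; split=> /eqP. Qed.

Lemma ideal_quot_eq0 (x : R) : \pi_{ideal_quot I} x = 0 <-> x \in I.
Proof. by rewrite -(rmorph0 \pi_{ideal_quot I}) ideal_quot_eq subr0. Qed.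

Lemma repr_pi_sub (x : R) : repr (\pi_{ideal_quot I} x) - x \in I.
Proof. by apply/ideal_quot_eq; rewrite reprK. Qed.

End IdealQuotient.

Section Cartier.
Variables (R : comNzRingType) (p : nat) (chRp : p \in [pchar R]).

Local Notation "R^( e )" := (frob_alg chRp e) (at level 0, format "R^( e )").

(** Stated for plain functions on [R], so that maps of different levels compose without a change of
    type. *)
Definition cartier e (phi : R -> R) : Prop :=
  forall a x y, phi (a ^+ (p ^ e) * x + y) = a * phi x + phi y.

Lemma cartierD e phi x y : cartier e phi -> phi (x + y) = phi x + phi y.
Proof. by move=> phiP; have := phiP 1 x y; rewrite expr1n !mul1r. Qed.

Lemma cartier0 e phi : cartier e phi -> phi 0 = 0.
Proof.
move=> phiP; have := phiP (-1) 0 0.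
by rewrite mulr0 addr0 mulN1r addNr.
Qed.

Lemma cartierZ e phi a x : cartier e phi -> phi (a ^+ (p ^ e) * x) = a * phi x.
Proof.
by move=> phiP; have := phiP a x 0; rewrite (cartier0 phiP) !addr0.
Qed.

Lemma cartierB e phi x y : cartier e phi -> phi (x - y) = phi x - phi y.
Proof.
move=> phiP; apply/eqP; rewrite eq_sym subr_eq -(cartierD _ _ phiP).
by rewrite subrK.
Qed.

Lemma cartier_linear e (phi : {linear R^(e) -> R^o}) : cartier e phi.
Proof. by move=> a x y; have := linearP phi a x y. Qed.

Lemma linear_cartier e phi : cartier e phi ->
  exists g : {linear R^(e) -> R^o}, g =1 phi.
Proof.
move=> phiP; pose g : R^(e) -> R^o := phi.
have gL : linear g by move=> a x y; exact: phiP.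
pose g' : {linear R^(e) -> R^o} := HB.pack g (GRing.isLinear.Build R _ _ _ g gL).
by exists g'.
Qed.

Lemma cartier_comp e f phi psi : cartier e phi -> cartier f psi ->
  cartier (e + f) (phi \o psi).
Proof. by move=> phiP psiP a x y /=; rewrite expnD exprM psiP phiP. Qed.

Lemma cartier_mulr e phi b : cartier e phi -> cartier e (fun x => phi (b * x)).
Proof. by move=> phiP a x y; rewrite mulrDr mulrCA phiP. Qed.

Lemma cartier_mull e phi b : cartier e phi -> cartier e (fun x => b * phi x).
Proof. by move=> phiP a x y; rewrite phiP mulrDr mulrCA. Qed.

Lemma frob_finite e : F_finite chRp -> finite_module R^(e).
Proof.
move=> [s sP]; elim: e => [|e [t tP]].
  exists [:: 1] => v; have -> : v = (v : R) *: (1 : R^(0)).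
    by rewrite /GRing.scale /= /frob_scale expr1 mulr1.
  apply: submoduleZ; first exact: module_span_submodule.
  by apply: sub_module_span; rewrite mem_head.
pose st : seq R^(e.+1) := [seq ((y : R) ^+ p * x : R) | x <- s, y <- t].
exists st => v.
have SS := module_span_submodule (fun w => w \in st).
have frobp (a b : R) : (a + b) ^+ p = a ^+ p + b ^+ p.
  by have := frobD chRp 1 a b; rewrite /= expn1.
have span_mul x a : x \in s ->
    module_span (fun w => w \in st) ((a : R) ^+ p * x : R).
  move=> xs; move: a (tP a).
  apply: (@module_span_min _ R^(e) _ (fun b =>
    module_span (fun w => w \in st) ((b : R) ^+ p * x : R))) => [|y yt]; last first.
    by apply: sub_module_span; exact: (@allpairs_f R R R (fun x y => y ^+ p * x)).
  split=> [|c y z Sy Sz].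
    by rewrite expr0n eqn0Ngt (prime_gt0 (pcharf_prime chRp)) mul0r; case: SS.
  suff -> : (c *: y + z : R) ^+ p * (x : R) =
      (c *: ((y : R) ^+ p * (x : R) : R^(e.+1)) + ((z : R) ^+ p * (x : R) : R) : R).
    exact: SS.2.
  rewrite /GRing.scale /= /frob_scale frobp.
  by rewrite exprMn -exprM -expnSr mulrDl mulrA.
have [l [ls ->]] := sP v.
have span_l c : c \in l -> module_span (fun w => w \in st) (c.1 *: c.2 : R).
  by move=> /ls cs; rewrite /GRing.scale /= /frob_scale expn1; exact: span_mul.
rewrite big_seq; exact: (@submodule_sum _ R^(e.+1) _ _ l (fun c => c \in l)
  (fun c => c.1 *: c.2 : R) SS span_l).
Qed.

End Cartier.

Section SplittingPrime.
Variables (R : comNzRingType) (m : idealr R) (p : nat) (chRp : p \in [pchar R]).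
Hypothesis noethR : noetherian R.
Hypothesis locR : local_ring m.
Hypothesis Ffin : F_finite chRp.
Local Notation "R^( e )" := (frob_alg chRp e) (at level 0, format "R^( e )").

Notation ideal := (@submodule R R^o).

Section Kernel.
Variables (E : lmodType R) (u : E).
Hypothesis injE : injective_module E.
Hypothesis u_neq0 : u <> 0.
Hypothesis u_gen : socle_generator m u.

Lemma frob_tensor_kernelP e r : frob_tensor_kernel chRp u e r <->
  ~ exists2 phi : R -> R, cartier p e phi & phi r = 1.
Proof.
split=> [ker [phi /(linear_cartier chRp)[g gE] phir]|no].
  by apply: (splitting_tensor u_neq0 (x := r : R^(e)) (g := g)) ker; rewrite gE.
apply: contrapT => /(tensor_splitting noethR locR injE u_neq0 u_gen)[|g gr].
  exact: frob_finite.
by apply: no; exists g => //; apply: cartier_linear.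
Qed.

(** Purity, applied to [E], keeps the image of [tens 1 u] under Frobenius nonzero in the tensor
    product with [R^(1)]. *)
Lemma F_pure_cartier : F_pure chRp -> exists2 phi : R -> R, cartier p 1 phi & phi 1 = 1.
Proof.
move=> Fpure; apply: contrapT => /frob_tensor_kernelP ker.
pose idg : R^o -> R^o := id.
have idL : linear idg by [].
pose g : {linear R^o -> R^o} := HB.pack idg (GRing.isLinear.Build R _ _ _ idg idL).
apply: (splitting_tensor u_neq0 (x := 1 : R^o) (g := g)) => //.
apply: (Fpure E); rewrite linear0 tensor_mapE; apply: etrans ker.
by congr tens; exact: expr1n.
Qed.

End Kernel.

(** The splitting prime described without [E]; [splitting_primeP] identifies the two. *)
Definition nonsplit (r : R) : Prop := forall e (phi : R -> R), cartier p e phi -> phi r \in m.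

Lemma nonsplitPn r : ~ nonsplit r ->
  exists e (phi : R -> R), cartier p e phi /\ phi r = 1.
Proof.
move=> /existsNP[e /existsNP[phi /not_implyP[phiP /negP/(local_unit noethR locR)[c cr]]]].
by exists e, (fun x => c * phi x); split=> //; apply: cartier_mull.
Qed.

Lemma split_nonsplit e phi r : cartier p e phi -> phi r = 1 -> ~ nonsplit r.
Proof. by move=> phiP phir /(_ _ _ phiP); rewrite phir idealr1. Qed.

Lemma nonsplit_ideal : ideal nonsplit.
Proof.
split=> [e phi phiP|a x y nx ny e phi phiP].
  by rewrite (cartier0 phiP) idealr0.
rewrite (cartierD _ _ phiP) rpredD ?(ny _ _ phiP) //.
exact: (nx _ _ (cartier_mulr a phiP)).
Qed.

Lemma nonsplit_cartier e phi r : cartier p e phi -> nonsplit r -> nonsplit (phi r).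
Proof. by move=> phiP nr f psi psiP; exact: (nr _ _ (cartier_comp psiP phiP)). Qed.

Lemma nonsplit_sub_max r : nonsplit r -> r \in m.
Proof.
move=> nr; have id0 : cartier p 0 (fun x : R => x) by move=> a x y; rewrite expr1.
exact: (nr _ _ id0).
Qed.

Lemma nonsplit_prime : prime_ideal nonsplit.
Proof.
split; first exact: nonsplit_ideal.
  by move=> /nonsplit_sub_max; rewrite idealr1.
move=> r s nrs; apply: contrapT => /not_orP[].
move=> /nonsplitPn[e [phi [phiP phir]]] /nonsplitPn[f [psi [psiP psis]]].
(* The power of [s] comes out of [phi] as [s], and [psi s] is 1; yet this element is a multiple of
   [r * s]. *)
apply: (split_nonsplit (cartier_comp psiP phiP) (r := s ^+ (p ^ e) * r)) => /=.
  by rewrite (cartierZ _ _ phiP) phir mulr1.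
have -> : s ^+ (p ^ e) = s ^+ (p ^ e).-1 * s.
  by rewrite -exprSr prednK // expn_gt0 (prime_gt0 (pcharf_prime chRp)).
by rewrite -mulrA [s * r]mulrC; apply: ideal_mull nrs; exact: nonsplit_ideal.
Qed.

Lemma splitting_primeP (E : lmodType R) (u : E) : injective_module E ->
    u <> 0 -> socle_generator m u -> F_pure chRp ->
  forall r, splitting_prime chRp u r <-> nonsplit r.
Proof.
move=> injE u0 ugen Fpure r.
have [phi1 phi1P phi11] := F_pure_cartier injE u0 ugen Fpure.
split=> [[e0 ker]|nr].
  apply: contrapT => /nonsplitPn[e [phi [phiP phir]]].
  (* Composition with [phi1], which fixes 1, raises the level by one. An element that splits at
     level [e] thus splits at all later levels. *)
  have [psi psiP psir] : exists2 psi, cartier p (e0 + e) psi & psi r = 1.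
    elim: e0 {ker} => [|k [psi psiP psir]]; first by exists phi.
    exists (phi1 \o psi); last by rewrite /= psir.
    by rewrite addSn -add1n; apply: cartier_comp.
  have /(frob_tensor_kernelP injE u0 ugen)[] := ker (e0 + e)%N (leq_addr _ _).
  by exists psi.
exists 0%N => e _; apply/(frob_tensor_kernelP injE u0 ugen) => -[phi phiP phir].
exact: split_nonsplit phiP phir nr.
Qed.

(** In the domain [R/Q] the zero ideal is a minimal prime, so that [c] is nonzero and its
    representative is outside [Q]. The Cartier map that sends this representative to 1 preserves [Q]
    and descends to [R/Q]. *)
Lemma nonsplit_quotient_regular (Q : prime_idealr R) :
  (forall r, r \in Q <-> nonsplit r) -> strongly_F_regular (quot_pchar Q chRp).
Proof.
move=> QP; pose A := {ideal_quot Q}.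
have domA (x y : A) : x * y = 0 -> x = 0 \/ y = 0.
  rewrite -[x]reprK -[y]reprK -rmorphM => /ideal_quot_eq0.
  by rewrite prime_idealrM => /orP[] ?; [left|right]; apply/ideal_quot_eq0.
split.
- move=> x n; elim: n => [|n IH]; first by rewrite expr0 => /eqP; rewrite oner_eq0.
  by rewrite exprS => /domA[].
- have [s sP] := Ffin.
  pose pis : seq (frob_alg (quot_pchar Q chRp) 1) := [seq \pi_A (x : R) | x <- s].
  exists pis => x; rewrite -[x]reprK; move: (repr (x : A)) => {}x.
  have SS := module_span_submodule (fun w => w \in pis).
  apply: (@module_span_min _ R^(1) _ (fun y =>
    module_span (fun w => w \in pis) (\pi_A (y : R)))) (sP x) => [|y ys].
    split=> [|a y z Sy Sz]; first by rewrite rmorph0; case: SS.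
    rewrite rmorphD rmorphM rmorphXn; exact: SS.2.
  by apply: sub_module_span; apply: map_f.
- move=> c cmin; have c0 : c <> 0.
    move=> c0; pose Z : A -> Prop := fun x => x = 0.
    have ZP : prime_ideal (R := A) Z.
      split=> [|/eqP|]; last exact: domA; last by rewrite oner_eq0.
      by split=> // a x y -> ->; rewrite scaler0 addr0.
    have [Q0 Q0P] := ideal_prime_idealr ZP.
    have Q0min : minimal_prime Q0.
      by move=> Q' Q'Q0 x; apply/idP/idP => [/Q'Q0//|/Q0P->]; exact: idealr0.
    by case/negP: (cmin Q0 Q0min); apply/Q0P.
  have /nonsplitPn[e [phi [phiP phic]]] : ~ nonsplit (repr c).
    by move=> /QP/ideal_quot_eq0; rewrite reprK.
  have phiQ x y : x - y \in Q -> \pi_A (phi x) = \pi_A (phi y).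
    move=> /QP nxy; apply/ideal_quot_eq; rewrite -(cartierB _ _ phiP).
    by apply/QP; apply: nonsplit_cartier.
  pose g (x : A) : A := \pi_A (phi (repr x)).
  have gpi x : g (\pi_A x) = \pi_A (phi x) by apply/phiQ/repr_pi_sub.
  have [g' g'E] : exists g' : {linear frob_alg (quot_pchar Q chRp) e -> A^o}, g' =1 g.
    apply: linear_cartier => a x y; rewrite -[a]reprK -[x]reprK -[y]reprK.
    rewrite -rmorphXn -rmorphM -rmorphD !gpi phiP rmorphD rmorphM //.
  exists e, g' => r; rewrite g'E.
  have -> : g (r *: (c : frob_alg (quot_pchar Q chRp) e)) =
      g (r ^+ (p ^ e) * c) by [].
  rewrite -[r]reprK -[c]reprK -rmorphXn -rmorphM gpi (cartierZ _ _ phiP) phic.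
  by rewrite mulr1.
Qed.

Lemma zero_nonsplit_regular :
  (forall r, nonsplit r -> r = 0) -> strongly_F_regular chRp.
Proof.
move=> n0; have [PI _ PP] := nonsplit_prime.
have nonsplit0 : nonsplit 0 by case: PI.
split=> // [x n|c cmin].
  elim: n => [|n IH]; first by rewrite expr0 => /eqP; rewrite oner_eq0.
  by rewrite exprS => xn; case: (PP x (x ^+ n)); rewrite ?xn // => /n0.
have [Q QP] := ideal_prime_idealr nonsplit_prime.
have /nonsplitPn[e [phi [phiP phic]]] : ~ nonsplit c.
  move=> /QP; apply/negP/cmin => Q' Q'Q x; apply/idP/idP => [/Q'Q//|].
  by move=> /QP/n0->; exact: idealr0.
have [g gE] := linear_cartier chRp phiP.
by exists e, g => r; rewrite gE /= (cartierZ _ _ phiP) phic mulr1.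
Qed.

Lemma regular_zero_nonsplit :
  strongly_F_regular chRp -> forall r, nonsplit r -> r = 0.
Proof.
move=> [redR _ SFR] r nr; apply: contrapT => r0.
pose Z : R^o -> Prop := fun x => x = 0.
have ZI : ideal Z by split=> // a x y -> ->; rewrite scaler0 addr0.
have radZ : radical_ideal Z by move=> x xx; apply: (redR x 2).
have [s [rs regc]] := regular_mod_exists noethR ZI radZ r0.
have [Q Qmin|e [g gK]] := SFR (r + s).
  (* A minimal prime that contained the nonzerodivisor [r + s] would strictly contain another
     prime. *)
  have [Q' [/ideal_prime_idealr[J JP] _ Q'Q nQ']] :=
    prime_below noethR ZI regc (prime_idealrP Q) (fun z (z0 : z = 0) =>
      eq_ind_r (fun z => z \in Q) (idealr0 Q) z0).
  apply/negP => cQ; apply: nQ'; apply/JP; rewrite (Qmin J) // => z /JP.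
  exact: Q'Q.
have gP := cartier_linear g.
have gc : g (r + s) = 1.
  by have := gK 1; rewrite /= scale1r.
have [t ts] : exists t, t * g s = 1.
  apply: (local_unit noethR locR); apply/negP => ms.
  have : 1 \in m by rewrite -gc (cartierD _ _ gP) rpredD // (nr _ _ gP).
  by rewrite idealr1.
apply: r0; rewrite -[r]mulr1 -ts mulrCA -(cartierZ _ _ gP).
have -> : r ^+ (p ^ e) = r ^+ (p ^ e).-1 * r.
  by rewrite -exprSr prednK // expn_gt0 (prime_gt0 (pcharf_prime chRp)).
by rewrite -mulrA rs mulr0 (cartier0 gP) mulr0.
Qed.

End SplittingPrime.

(** * Growth of the free rank *)

Section FreeRank.
Variables (R : comNzRingType) (m : idealr R) (p : nat) (chRp : p \in [pchar R]).
Hypothesis noethR : noetherian R.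
Hypothesis perf : perfect p {ideal_quot m}.
Local Notation "R^( e )" := (frob_alg chRp e) (at level 0, format "R^( e )").
Notation ideal := (@submodule R R^o).

Definition frob_span e (ws : seq R) : R -> Prop :=
  @module_span R R^(e) (fun w => (w : R) \in ws).

Lemma frob_span_submodule e ws : @submodule R R^(e) (frob_span e ws).
Proof. exact: module_span_submodule. Qed.

Lemma frob_spanD e ws (x y : R) :
  frob_span e ws x -> frob_span e ws y -> frob_span e ws (x + y).
Proof. exact: (submoduleD (frob_span_submodule e ws)). Qed.

Lemma frob_spanZ e ws (a x : R) :
  frob_span e ws x -> frob_span e ws (a ^+ (p ^ e) * x).
Proof. exact: (submoduleZ _ (frob_span_submodule e ws)). Qed.

Lemma frob_span_gen e ws (x : R) : x \in ws -> frob_span e ws x.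
Proof. by move=> xws; apply: (@sub_module_span R R^(e)). Qed.

Lemma frob_span0 e ws : frob_span e ws (0 : R).
Proof. exact: (frob_span_submodule e ws).1. Qed.

Lemma frob_span_min e ws (S : R -> Prop) : S 0 ->
    (forall a x y, S x -> S y -> S (a ^+ (p ^ e) * x + y)) ->
    (forall x, x \in ws -> S x) ->
  forall x, frob_span e ws x -> S x.
Proof. by move=> S0 SD; apply: (@module_span_min R R^(e)); split. Qed.

Lemma perfect_root e (c : R) : exists b, c - b ^+ (p ^ e) \in m.
Proof.
have [y yc] : exists y : {ideal_quot m}, y ^+ (p ^ e) = \pi c.
  elim: e => [|e [y yc]]; first by exists (\pi c); rewrite expr1.
  by have [z zy] := perf y; exists z; rewrite expnS exprM zy.
exists (repr y); apply/ideal_quot_eq.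
by rewrite -yc rmorphXn /= reprK.
Qed.

(** The list [ws] serves all [e] at once. When a socle element [x] of [R/J] is added, its
    coefficient matters only modulo [m], and the perfectness of the residue field makes it a
    [p ^ e]-th power there. *)
Lemma primary_span J : ideal J -> primary m J ->
  exists ws : seq R, forall e r, exists2 w, frob_span e ws w & J (r - w).
Proof.
move: J; apply: (primary_ind noethR) => [J JI J1|J x JI Jm nJx mx [ws wsP]].
  exists [::] => e r; exists 0; first exact: frob_span0.
  by rewrite -[_ - _]mulr1; apply: (ideal_mull _ JI).
exists (x :: ws) => e r; have [w ww [a Ja]] := wsP e r.
have [b mb] := perfect_root e a.
exists (b ^+ (p ^ e) * x + w).
  apply: frob_spanD.
    by apply: frob_spanZ; apply: frob_span_gen; rewrite mem_head.
  move: ww; apply: frob_span_min; first exact: frob_span0.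
    by move=> c y z Sy Sz; apply: frob_spanD => //; apply: frob_spanZ.
  by move=> y yws; apply: frob_span_gen; rewrite inE yws orbT.
have -> : r - (b ^+ (p ^ e) * x + w) = (r - w - a * x) + (a - b ^+ (p ^ e)) * x by ring.
by apply: (submoduleD JI) => //; apply: mx.
Qed.

(** Approximating the coefficient of [x ^+ k] modulo [J + R x] raises the exponent by one; after
    [p ^ e] rounds the generators used are the [x ^+ k * w] with [k < p ^ e]. *)
Lemma adjoin_power_span e (J : R^o -> Prop) (x : R) (ws : seq R) : ideal J ->
    (forall r, exists2 w, frob_span e ws w & adjoin J x (r - w)) ->
  exists2 ws', size ws' = (p ^ e * size ws)%N &
    forall r, exists2 w, frob_span e ws' w & adjoin J (x ^+ (p ^ e)) (r - w).
Proof.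
move=> JI Jx.
pose ws' := [seq x ^+ k * w | k <- iota 0 (p ^ e), w <- ws].
exists ws' => [|]; first by rewrite size_allpairs size_iota.
suff H k : (k <= p ^ e)%N -> forall r,
    exists2 w, frob_span e ws' w & adjoin J (x ^+ k) (r - w) by exact: H.
elim: k => [_ r|k IH ltk r].
  exists 0; first exact: frob_span0.
  by exists r; rewrite subr0 mulr1 subrr; case: JI.
have [w ww [a Ja]] := IH (ltnW ltk) r; have [w1 ww1 [b Jb]] := Jx a.
exists (w + x ^+ k * w1).
  apply: frob_spanD => //; move: ww1.
  apply: (frob_span_min (S := fun w1 => frob_span e ws' (x ^+ k * w1)))
    => [|c y z Sy Sz|y yws].
  - by rewrite mulr0; exact: frob_span0.
  - by rewrite mulrDr mulrCA; apply: frob_spanD => //; apply: frob_spanZ.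
  - by apply: frob_span_gen; apply: allpairs_f; rewrite ?mem_iota.
exists b; rewrite exprS.
have -> : r - (w + x ^+ k * w1) - b * (x * x ^+ k) =
    (r - w - a * x ^+ k) + x ^+ k * (a - w1 - b * x) by ring.
by apply: (submoduleD JI) => //; apply: (ideal_mull _ JI).
Qed.

Lemma extend_ideal (J : R^o -> Prop) xs : ideal (extend J xs).
Proof. exact: module_span_submodule. Qed.

Lemma extend_base (J : R^o -> Prop) xs z : J z -> extend J xs z.
Proof. by move=> Jz; apply: sub_module_span; left. Qed.

Lemma extend_gen (J : R^o -> Prop) xs x : x \in xs -> extend J xs x.
Proof. by move=> xxs; apply: sub_module_span; right. Qed.

Lemma extend_consP (J : R^o -> Prop) x xs z : ideal J ->
  extend J (x :: xs) z -> adjoin (extend J xs) x z.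
Proof.
move=> JI; move: z; apply: module_span_min; first exact: (adjoin_ideal _ (extend_ideal J xs)).
move=> z [Jz|]; first by apply: sub_adjoin; apply: extend_base.
rewrite inE => /predU1P[->|zxs]; first exact: mem_adjoin (extend_ideal J xs).
by apply: sub_adjoin; apply: extend_gen.
Qed.

Lemma extend_power_span e xs (J : R^o -> Prop) (ws : seq R) : ideal J ->
    (forall r, exists2 w, frob_span e ws w & extend J xs (r - w)) ->
  exists2 ws', size ws' = ((p ^ e) ^ size xs * size ws)%N &
    forall r, exists2 w, frob_span e ws' w &
      extend J [seq x ^+ (p ^ e) | x <- xs] (r - w).
Proof.
elim: xs J ws => [|x xs IH] J ws JI Jxs; first by exists ws; rewrite ?mul1n.
have [|ws1 sws1 ws1P] := @adjoin_power_span e (extend J xs) x ws (extend_ideal J xs).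
  by move=> r; have [w ww Jw] := Jxs r; exists w => //; apply: extend_consP.
(* The power of [x] moves into the base ideal before the remaining elements are treated. *)
pose y := x ^+ (p ^ e); pose J2 := extend J [:: y].
have [|ws' sws' ws'P] := IH J2 ws1 (extend_ideal J [:: y]).
  move=> r; have [w ww [a Ja]] := ws1P r; exists w => //.
  rewrite -[r - w](subrK (a * y)); apply: (submoduleD (extend_ideal J2 xs)).
    move: Ja; apply: module_spanS => z [Jz|]; last by right.
    by left; apply: extend_base.
  apply: (ideal_mull _ (extend_ideal J2 xs)); apply: extend_base.
  by apply: extend_gen; rewrite mem_head.
exists ws' => [|r]; first by rewrite sws' sws1 expnS /= mulnA [(p ^ e * _)%N]mulnC.
have [w ww Jw] := ws'P r; exists w => //; move: Jw; apply: module_span_min.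
  exact: extend_ideal.
move=> z [J2z|zxs]; last by apply: extend_gen; rewrite inE zxs orbT.
move: z J2z; apply: module_spanS => z [Jz|]; first by left.
by rewrite mem_seq1 => /eqP->; right; rewrite mem_head.
Qed.

(** The coordinates on the free summand are Cartier maps [phi i], with a dual family [d j]. Modulo
    [m] they do not see [K], so [d j] may be replaced by a combination of [ws]; the identity matrix
    of size [a] then factors through size [size ws]. *)
Lemma free_summand_bound e a (N : lmodType R) (ws : seq R) (K : R -> Prop) :
    (forall phi : R -> R, cartier p e phi -> forall z, K z -> phi z \in m) ->
    (forall r, exists2 w, frob_span e ws w & K (r - w)) ->
  isomorphic R^(e) ('rV[R]_a * N)%type -> (a <= size ws)%N.
Proof.
move=> phiK wsP [f [f' fK f'K]].
pose phi i (x : R) : R := (f (x : R^(e))).1 0 i.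
have phiP i : cartier p e (phi i).
  by move=> c x y; rewrite /phi; have /= -> := linearP f c x y; rewrite !mxE.
pose d (j : 'I_a) : R := f' (delta_mx 0 j, 0).
have phid i j : phi i (d j) = (i == j)%:R.
  by rewrite /phi /d f'K mxE eqxx.
have /choice[w wP] j : exists w, frob_span e ws w /\ K (d j - w).
  by have [w] := wsP (d j); exists w.
have /choice[c cP] (j : 'I_a) : exists c : 'rV[R]_(size ws),
    w j = \sum_l (c 0 l) ^+ (p ^ e) * ws`_l.
  have [c cE] := @module_span_nth R R^(e) ws _ (wP j).1.
  by exists c; rewrite cE.
pose C : 'M[{ideal_quot m}]_(a, size ws) := \matrix_(j, l) \pi_{ideal_quot m} (c j 0 l).
pose D : 'M[{ideal_quot m}]_(size ws, a) := \matrix_(l, i) \pi_{ideal_quot m} (phi i ws`_l).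
apply: (@mulmx1_min _ _ _ C D); apply/matrixP => j i; rewrite !mxE.
have -> : \sum_l C j l * D l i = \pi_{ideal_quot m} (phi i (w j)).
  rewrite cP; have phi_sum (r : seq 'I_(size ws)) F :
      phi i (\sum_(l <- r) F l) = \sum_(l <- r) phi i (F l).
    by elim/big_rec2: _ => [|l x y _ <-]; [exact: cartier0 (phiP i)|exact: cartierD (phiP i)].
  rewrite phi_sum rmorph_sum; apply: eq_bigr => l _.
  by rewrite !mxE (cartierZ _ _ (phiP i)) rmorphM.
have -> : (j == i)%:R = \pi_{ideal_quot m} (phi i (d j)).
  by rewrite phid eq_sym rmorph_nat.
apply/esym/ideal_quot_eq; rewrite -(cartierB _ _ (phiP i)).
exact: phiK (phiP i) _ (wP j).2.
Qed.

Lemma free_summand_growth xs : (forall x, x \in xs -> x \in m) ->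
    primary m (extend (nonsplit m p) xs) ->
  exists C, forall e a (N : lmodType R),
    isomorphic R^(e) ('rV[R]_a * N)%type -> (a <= C * (p ^ e) ^ size xs)%N.
Proof.
move=> xsm Jm; have [ws wsP] := primary_span (extend_ideal _ xs) Jm.
exists (size ws) => e a N iso.
have [ws' sws' ws'P] := extend_power_span (nonsplit_ideal m p) (wsP e).
rewrite mulnC -sws'; apply: free_summand_bound ws'P iso => phi phiP z Kz.
(* This ideal contains the nonsplit elements by definition, and the powers [x ^+ (p ^ e)] because
   [x] comes out of [phi]. *)
pose S z := forall phi : R -> R, cartier p e phi -> phi z \in m.
have SI : ideal S.
  split=> [psi psiP|b x y Sx Sy psi psiP]; first by rewrite (cartier0 psiP) idealr0.
  rewrite (cartierD _ _ psiP) rpredD ?(Sy _ psiP) //.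
  exact: (Sx _ (cartier_mulr b psiP)).
move: z Kz phi phiP; apply: (module_span_min SI) => z [nz|/mapP[x /xsm mx ->]] phi phiP.
  exact: nz phiP.
by rewrite -[_ ^+ _]mulr1 (cartierZ _ _ phiP) mulrC idealMr.
Qed.

Lemma isomorphic_summand (M N N' : lmodType R) a n :
    isomorphic M ('rV[R]_a * N)%type -> isomorphic N ('rV[R]_n * N')%type ->
  isomorphic M ('rV[R]_(a + n) * N')%type.
Proof.
move=> [f [f' fK f'K]] [g [g' gK g'K]].
pose h (x : M) : ('rV[R]_(a + n) * N')%type :=
  (row_mx (f x).1 (g (f x).2).1, (g (f x).2).2).
have hL : linear h.
  move=> c x y; rewrite /h !linearP /=.
  by congr pair; rewrite -add_row_mx -scale_row_mx.
pose h0 : {linear M -> ('rV[R]_(a + n) * N')%type} :=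
  HB.pack h (GRing.isLinear.Build R _ _ _ h hL).
exists h0; exists (fun z => f' (lsubmx z.1, g' (rsubmx z.1, z.2))) => [x|[v y]] /=.
  by rewrite /h /= row_mxKl row_mxKr -surjective_pairing gK -surjective_pairing fK.
by rewrite /h /= f'K /= g'K /= hsubmxK.
Qed.

Lemma split_summand e (phi : R -> R) : cartier p e phi -> phi 1 = 1 ->
  exists N : lmodType R, isomorphic R^(e) ('rV[R]_1 * N)%type.
Proof.
move=> phiP phi1.
pose U : R^(e) -> Prop := fun x => exists a : R, x = a ^+ (p ^ e).
have UZ a : U (a ^+ (p ^ e)) by exists a.
have US : submodule U.
  split=> [|a _ _ [b ->] [c ->]].
    by exists 0; rewrite expr0n eqn0Ngt expn_gt0 (prime_gt0 (pcharf_prime chRp)).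
  by exists (a * b + c); rewrite (frobD chRp) exprMn.
pose S := span_submod U; exists (modquot S).
have SP (x : R^(e)) : x \in S <-> U x by exact: mem_span_submodule.
pose f (x : R^(e)) : ('rV[R]_1 * modquot S)%type := (const_mx (phi x), mod_pi S x).
have fL : linear f.
  move=> a x y; rewrite /f linearP; congr pair.
  by apply/rowP => i; rewrite !mxE; exact: phiP.
pose f0 : {linear R^(e) -> ('rV[R]_1 * modquot S)%type} :=
  HB.pack f (GRing.isLinear.Build R _ _ _ f fL).
have phiq a : phi (a ^+ (p ^ e)) = a.
  by rewrite -[a ^+ _]mulr1 (cartierZ _ _ phiP) phi1 mulr1.
(* The second summand lifts a class of the quotient to its representative in the kernel of [phi]. *)
pose h (z : ('rV[R]_1 * modquot S)%type) : R^(e) :=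
  let y : R := mod_repr z.2 in (z.1 0 0) ^+ (p ^ e) + (y - phi y ^+ (p ^ e)).
exists f0; exists h => [x|[v y]] /=; rewrite /f /h /=.
  have /SP[c] : (mod_repr (mod_pi S x) - x) \in S by apply/mod_piP; rewrite mod_reprK.
  move=> /eqP; rewrite subr_eq => /eqP->; rewrite mxE.
  rewrite (cartierD _ _ phiP) phiq (frobD chRp).
  by rewrite addrC -addrA [- _ + _]addrC; ring.
congr pair.
  apply/rowP => i; rewrite !mxE (cartierD _ _ phiP) (cartierB _ _ phiP) !phiq.
  by rewrite subrr addr0 ord1.
rewrite -[RHS]mod_reprK; apply/mod_piP/SP.
exists (v 0 0 - phi (mod_repr y)).
have /= := frobD chRp e (v 0 0 - phi (mod_repr y)) (phi (mod_repr y)).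
by rewrite subrK => ->; ring.
Qed.

End FreeRank.

(** * Lower limits and the s-dimension *)

Section Liminf.
Variable K : realType.
Implicit Types u : nat -> \bar K.

Lemma limn_einf_ge u (c : \bar K) :
  (forall n, (c <= u n)%E) -> (c <= limn_einf u)%E.
Proof.
move=> cu; rewrite limn_einf_lim; apply: lime_ge; first exact: is_cvg_einfs.
by apply: nearW => n; apply: le_ereal_inf_tmp => _ [k _ <-].
Qed.

Lemma limn_einf_le0 u (C : K) (q : nat) : (1 < q)%N ->
  (forall n, (u n <= (C / (q ^ n)%:R)%:E)%E) -> (limn_einf u <= 0)%E.
Proof.
move=> q1 uC; rewrite limn_einf_lim; apply: lime_le; first exact: is_cvg_einfs.
apply: nearW => n; apply/lee_addgt0Pr => eps eps0; rewrite add0e.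
(* The index lies in the tail from [n] on, and [C / eps] is less than [k], hence less than
   [q ^ k]. *)
pose k := (n + Num.bound `|C / eps|)%N.
apply: (@le_trans _ _ (u k)).
  by apply: ereal_inf_lbound; exists k => //=; exact: leq_addr.
apply: le_trans (uC k) _; rewrite lee_fin.
have qk0 : 0 < (q ^ k)%:R :> K by rewrite ltr0n expn_gt0 (ltnW q1).
rewrite ler_pdivrMr // mulrC -ler_pdivrMr //.
apply: le_trans (ler_norm _) (ltW (lt_le_trans (archi_boundP (normr_ge0 _)) _)).
by rewrite ler_nat; exact: leq_trans (leq_addl _ _) (ltnW (ltn_expl k q1)).
Qed.

(** For [j] larger than [d] the quotients are at most [C / p ^ e], so their lower limit is not
    positive. *)
Lemma liminf_growth_le (p C d : nat) (a : nat -> nat) (j : int) : (1 < p)%N ->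
    (forall e, a e <= C * (p ^ e) ^ d)%N ->
    (0 < limn_einf (fun e => ((a e)%:R / (p ^ e)%:R ^ j : K)%:E))%E ->
  (j <= d%:Z)%R.
Proof.
move=> p1 aC; rewrite ltNge => /negP pos; rewrite leNgt; apply/negP => ltdj.
apply: pos; apply: (@limn_einf_le0 _ C%:R p) => // e; rewrite lee_fin.
have [k ->] : exists k : nat, j = (d + k.+1)%N%:Z.
  case: j ltdj => // j; rewrite ltz_nat => ltdj.
  by exists (j - d.+1)%N; rewrite addnS -addSn subnKC.
have q0 : 0 < (p ^ e)%:R :> K by rewrite ltr0n expn_gt0 (ltnW p1).
have q1 : 1 <= (p ^ e)%:R :> K by rewrite ler1n expn_gt0 (ltnW p1).
rewrite -exprnP exprD exprSr ler_pdivrMr ?mulr_gt0 ?exprn_gt0 //.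
set q : K := (p ^ e)%:R in q0 q1 *.
have -> : C%:R / q * (q ^+ d * (q ^+ k * q)) = C%:R * q ^+ d * q ^+ k.
  by rewrite mulrACA [_ * (q ^+ k * q)]mulrA; field; rewrite gt_eqF.
apply: (@le_trans _ _ (C%:R * q ^+ d)).
  by rewrite -natrX -natrM ler_nat.
by rewrite ler_peMr ?exprn_ege1 // mulr_ge0 ?ler0n // exprn_ge0 // ltW.
Qed.

(** The exponent 0 is admissible because the ranks are positive, and [d] bounds all admissible ones.
    A maximum over the natural numbers also dominates the negative exponents. *)
Lemma sdim_exists (R : comNzRingType) (p : nat) (chRp : p \in [pchar R])
    (a : nat -> nat) (C d : nat) :
    (forall e, free_rank (frob_alg chRp e) (a e)) -> (forall e, 0 < a e)%N ->
    (forall e, a e <= C * (p ^ e) ^ d)%N ->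
  exists s : nat, is_sdim chRp K s%:Z /\
    (0 < limn_einf (fun e => ((a e)%:R / (p ^ e)%:R ^ s%:Z : K)%:E))%E.
Proof.
move=> arank a0 aC; have p1 := prime_gt1 (pcharf_prime chRp).
pose pos (j : int) := (0 < limn_einf (fun e => ((a e)%:R / (p ^ e)%:R ^ j : K)%:E))%E.
have pos0 : exists s : nat, pos s%:Z.
  exists 0%N; apply: lt_le_trans (_ : (0 < 1%:E)%E) _; first by rewrite lte_fin ltr01.
  by apply: limn_einf_ge => e; rewrite lee_fin expr0z divr1 ler1n.
have posd (s : nat) : pos s%:Z -> (s <= d)%N by move=> /(liminf_growth_le p1 aC).
have [s poss smax] := ex_maxnP pos0 posd.
exists s; split=> //; exists a; split=> //; split=> // -[j|j] posj //.
by rewrite lez_nat; apply: smax.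
Qed.

End Liminf.

(** * Existence of the free rank *)

Section FreeRankExists.
Variables (R : comNzRingType) (p : nat) (chRp : p \in [pchar R]).
Local Notation "R^( e )" := (frob_alg chRp e) (at level 0, format "R^( e )").

(** The rank of a largest free summand works: a free summand of its complement would enlarge it. *)
Lemma free_rank_exists e a0 b :
    (exists N : lmodType R, isomorphic R^(e) ('rV[R]_a0 * N)%type) ->
    (forall a (N : lmodType R), isomorphic R^(e) ('rV[R]_a * N)%type -> (a <= b)%N) ->
  exists2 a, (a0 <= a)%N & free_rank R^(e) a.
Proof.
move=> iso0 bound.
pose rank a := `[< exists N : lmodType R, isomorphic R^(e) ('rV[R]_a * N)%type >].
have rank0 : exists a, rank a by exists a0; apply/asboolP.
have [|a /asboolP[N isoN] amax] := @ex_maxnP rank b rank0.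
  by move=> a /asboolP[N]; apply: bound.
exists a; first by apply: amax; apply/asboolP.
exists N; split=> // n N' isoN'; apply/eqP; rewrite -leqn0 -(leq_add2l a) addn0.
by apply: amax; apply/asboolP; exists N'; apply: isomorphic_summand isoN isoN'.
Qed.

End FreeRankExists.

(** * Chains of primes in a quotient ring *)

Section Dimension.
Variable R : comNzRingType.

Lemma chain_to_seq (P : R^o -> Prop) n Q : chain_to P n Q ->
  exists f : nat -> R^o -> Prop,
    [/\ f n = Q, forall i, (i <= n)%N -> prime_ideal (f i) /\ forall x, P x -> f i x
      & forall i, (i < n)%N -> (forall x, f i x -> f i.+1 x) /\
          exists2 x, f i.+1 x & ~ f i x].
Proof.
elim: n Q => [|n IH] Q [QP PQ H].
  by exists (fun=> Q); split=> // i; rewrite leqn0 => /eqP->.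
have [Q' /IH[f [fn fP fS]] [Q'Q [x Qx nQ'x]]] := H.
exists (fun i => if (i <= n)%N then f i else Q); split=> [|i|i].
- by rewrite ltnn.
- by move=> _; case: leqP => // lein; apply: fP.
- move=> lein; have [->|nein] := eqVneq i n.
    by rewrite ltnn leqnn fn; split=> //; exists x.
  have ltin : (i < n)%N by rewrite ltn_neqAle nein -ltnS.
  by rewrite ltin (ltnW ltin); apply: fS.
Qed.

Lemma chain_to_dim (K : realType) (Q : prime_idealr R) n Q' :
    chain_to (fun x => x \in Q) n Q' ->
  (n%:R%:E <= krull_dim {ideal_quot Q} K)%E.
Proof.
move=> /chain_to_seq[f [_ fP fS]]; apply: ereal_sup_ubound; exists n => //=.
pose A := {ideal_quot Q}.
(* The primes of the chain contain [Q], so membership does not depend on the representative. *)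
have f_pi i x : (i <= n)%N -> f i (repr (\pi_A x)) <-> f i x.
  move=> /fP[[fI _ _] Qf]; have Qx := Qf _ (repr_pi_sub Q x).
  split=> fx; first by rewrite -[x](subKr (repr (\pi_A x))); apply: (submoduleB fI).
  by rewrite -[repr _](subrK x); apply: (submoduleD fI).
have primeA (i : 'I_n.+1) : prime_ideal (R := A) (fun x : A => f i (repr x)).
  have lein : (i <= n)%N by rewrite -ltnS.
  have [[fI f1 fM] _] := fP i lein.
  split; first split.
  - by rewrite -(rmorph0 \pi_A); apply/f_pi => //; case: fI.
  - move=> a x y; rewrite -[a]reprK -[x]reprK -[y]reprK !f_pi // => fx fy.
    suff -> : \pi_A (repr a) *: (\pi_A (repr x) : A^o) + \pi_A (repr y) =
        \pi_A (repr a * repr x + repr y) by apply/f_pi => //; apply: fI.2.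
    by rewrite rmorphD rmorphM.
  - by rewrite -(rmorph1 \pi_A) f_pi.
  - move=> x y; rewrite -[x]reprK -[y]reprK -rmorphM !f_pi //; exact: fM.
exists (fun i => sval (ideal_prime_idealr (primeA i))) => i j ltij.
have memP k x : x \in sval (ideal_prime_idealr (primeA k)) <-> f k (repr x).
  by case: (ideal_prime_idealr _).
have lef k l : (k <= l <= n)%N -> forall x, f k x -> f l x.
  move=> /andP[/subnKC <-]; elim: (l - k)%N => [|r IH]; first by rewrite addn0.
  rewrite addnS => ltrn x fx; apply: (fS _ ltrn).1; exact: IH (ltnW ltrn) x fx.
have ltjn : (j <= n)%N by rewrite -ltnS.
split=> [x /memP fx|sub]; first by apply/memP; apply: lef fx; rewrite (ltnW ltij).
have ltin := leq_trans ltij ltjn.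
have [fS1 [x fx nfx]] := fS i ltin; apply: nfx.
apply/(f_pi _ _ (ltnW ltin)); apply/memP/sub/memP/(f_pi _ _ ltjn).
by apply: lef fx; rewrite ltij.
Qed.

End Dimension.

(** The image of 1 under [iota] is a nonzero element of the socle. *)
Lemma hull_socle_neq0 (R : comNzRingType) (m : idealr R) (E : lmodType R)
    (iota : {linear {ideal_quot m} -> E}) (u : E) :
  injective iota -> socle_generator m u -> u <> 0.
Proof.
move=> iotaI u_gen u0.
have : socle m (iota 1).
  move=> r mr; rewrite -linearZ /=; have -> : r *: (1 : {ideal_quot m}) = 0.
    by rewrite /GRing.scale /= /quot_scale mulr1; apply/ideal_quot_eq0.
  exact: linear0.
move=> /u_gen[r]; rewrite u0 scaler0 -(linear0 iota) => /iotaI/eqP.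
by rewrite oner_eq0.
Qed.

Theorem theorem1p1 (K : realType) (R : comNzRingType) (m : idealr R)
    (p : nat) (chRp : p \in [pchar R])
    (R_noetherian : noetherian R) (R_local : local_ring m)
    (R_Ffinite : F_finite chRp) (R_Fpure : F_pure chRp)
    (kappa_perfect : perfect p {ideal_quot m})
    (E : lmodType R) (iota : {linear {ideal_quot m} -> E})
    (E_hull : injective_hull iota)
    (u : E) (u_gen : socle_generator m u) :
  exists P : prime_idealr R,
    [/\ forall r, r \in P <-> splitting_prime chRp u r,
        strongly_F_regular (quot_pchar P chRp),
        exists s : int, is_sdim chRp K s /\
          ((s%:~R)%:E <= krull_dim {ideal_quot P} K)%E
      & (forall r, r \in P <-> r = 0) <-> strongly_F_regular chRp].
Proof.
have [injE iotaI _] := E_hull.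
have u0 := hull_socle_neq0 iotaI u_gen.
have primeN := nonsplit_prime chRp R_noetherian R_local.
have [P PN] := ideal_prime_idealr primeN.
have splitP := splitting_primeP R_noetherian R_local R_Ffinite injE u0 u_gen R_Fpure.
exists P; split.
- by move=> r; rewrite PN splitP.
- exact: nonsplit_quotient_regular PN.
- have [phi1 phi1P phi11] :=
    F_pure_cartier R_noetherian R_local R_Ffinite injE u0 u_gen R_Fpure.
  have split1 e : exists2 phi : R -> R, cartier p e phi & phi 1 = 1.
    elim: e => [|e [phi phiP phi_1]].
      by exists id => // a x y; rewrite expr1.
    by exists (phi1 \o phi); [exact: cartier_comp phi1P phiP|rewrite /= phi_1].
  have growth xs := @free_summand_growth R m p chRp R_noetherian kappa_perfect xs.
  (* Generators of [m] give a crude polynomial bound, enough for the free ranks and the s-dimension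
     [s] to exist. *)
  have [g gP] := R_noetherian m.
  have [|x mx|C boundC] := growth g.
  + by move=> x xg; apply/gP; apply: (@sub_module_span R R^o).
  + exists 1%N; rewrite expr1; move: x mx => x /gP.
    by apply: module_spanS => y; right.
  have /choice[a aP] e : exists a, free_rank (frob_alg chRp e) a /\ (0 < a)%N.
    have [phi phiP phi_1] := split1 e.
    have [a a0 ra] := free_rank_exists (split_summand chRp phiP phi_1) (@boundC e).
    by exists a.
  have rank_a e := (aP e).1; have a_gt0 e := (aP e).2.
  have a_le xs D : (forall e a (N : lmodType R),
      isomorphic (frob_alg chRp e) ('rV[R]_a * N)%type ->
        (a <= D * (p ^ e) ^ size xs)%N) ->
    forall e, (a e <= D * (p ^ e) ^ size (xs : seq R))%N.
    by move=> bound e; have [N [iso _]] := rank_a e; apply: bound iso.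
  have [s [sdim pos]] := sdim_exists K rank_a a_gt0 (a_le _ _ boundC).
  exists s%:Z; split=> //; change ((s%:R)%:E <= krull_dim {ideal_quot P} K)%E.
  (* Either [R/P] has a chain of [s + 1] primes, or fewer than [s] elements suffice for the growth
     bound, against the positive lower limit at exponent [s]. *)
  have [|[xs [xs_s xsm /(growth _ xsm)[D boundD]]]] :=
    chain_or_primary R_noetherian R_local primeN s.
    have -> : nonsplit m p = (fun x => x \in P).
      by apply/funext => x; apply/propext; rewrite PN.
    exact: chain_to_dim.
  have := liminf_growth_le (prime_gt1 (pcharf_prime chRp)) (a_le _ _ boundD) pos.
  by rewrite lez_nat leqNgt xs_s.
- split=> [P0|SFR r].
    by apply: (zero_nonsplit_regular R_noetherian R_local R_Ffinite) => r /PN/P0.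
  rewrite PN; split=> [|->]; first exact: (regular_zero_nonsplit R_noetherian R_local SFR).
  by case: primeN => -[].
Qed.
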